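(* Let $(\lambda,\lambda',\lambda'')$ be a regular triple of weights and put $\lambda_1=\lambda$, $\lambda_2=\lambda'$, $\lambda_3=\lambda''$, $\lambda_0=\lambda\lambda'\lambda''$, $\lambda_4=\lambda\lambda'$, $\lambda_5=\lambda'\lambda''$, with $\lambda_i=(x_i,y_i)$. Consider $$\mathbf T_{\lambda_1,\lambda_2,\lambda_3}:M_{\lambda_4,\lambda_3}^{\lambda_0}\otimes M_{\lambda_1,\lambda_2}^{\lambda_4}\to M_{\lambda_2,\lambda_3}^{\lambda_5}\otimes M_{\lambda_1,\lambda_5}^{\lambda_0},\qquad \mathbf T_{\lambda_3,\lambda_0^*,\lambda_1}:M_{\lambda_4^*,\lambda_1}^{\lambda_2^*}\otimes M_{\lambda_3,\lambda_0^*}^{\lambda_4^*}\to M_{\lambda_0^*,\lambda_1}^{\lambda_5^*}\otimes M_{\lambda_3,\lambda_5^*}^{\lambda_2^*}.$$ Then $\mathbf T_{\lambda_3,\lambda_0^*,\lambda_1}$ makes sense as a $\mathbf T$ map (i.e. $(\lambda_3,\lambda_0^*,\lambda_1)$ is a regular triple with $\lambda_3\lambda_0^*=\lambda_4^*$, $\lambda_0^*\lambda_1=\lambda_5^*$, $\lambda_3\lambda_0^*\lambda_1=\lambda_2^*$), and $$(\mathbf T_{\lambda_3,\lambda_0^*,\lambda_1})_{21}\,(\mathbf A_{\lambda_4^*,\lambda_1}^{\lambda_2^*})_2^{-1}\,(\mathbf A_{\lambda_4,\lambda_3}^{\lambda_0})_1=q^{2m}\,(\mathbf A_{\lambda_0^*,\lambda_1}^{\lambda_5^*})_2^{-1}\,(\mathbf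 A_{\lambda_2,\lambda_3}^{\lambda_5})_1\,(\mathbf T_{\lambda_1,\lambda_2,\lambda_3})_{12}$$ as maps $M_{\lambda_4,\lambda_3}^{\lambda_0}\otimes M_{\lambda_1,\lambda_2}^{\lambda_4}\to M_{\lambda_3,\lambda_5^*}^{\lambda_2^*}\otimes M_{\lambda_0^*,\lambda_1}^{\lambda_5^*}$, where $m=m_{x_1,x_2}-m_{x_1,x_2x_3}$.
   Context: $N$ is a fixed odd positive integer, $q=e^{\pi\sqrt{-1}/N}$. $\mathcal W$ is the Hopf algebra over $\mathbb C$ generated by $X^{\pm1},Y$ with $XY=q^2YX$, $\Delta X=X\otimes X$, $\Delta Y=Y\otimes X+1\otimes Y$, $\epsilon(X)=1$, $\epsilon(Y)=0$, $S(X)=X^{-1}$, $S(Y)=-YX^{-1}$. Representations are finite dimensional complex left $\mathcal W$-modules; tensor products are formed via $\Delta$; a representation is trivial if each $W$ acts by $\epsilon(W)\,\mathrm{id}$. $e_0,\dots,e_{N-1}$ is the standard basis of $\mathbb C^N$, indices mod $N$; $Ae_k=q^{2k}e_k$, $Be_k=e_{k+1}$. For each $z\in\mathbb C^\times$ an $N$-th root $z^{1/N}$ is fixed, with $1^{1/N}=1$, $(z^{1/N})^{-1}=(z^{-1})^{1/N}=:z^{-1/N}$, $(-z)^{1/N}=-z^{1/N}$; $m_{z,w}\in\{0,\dots,N-1\}$ is defined by $(zw)^{1/N}=q^{2m_{z,w}}z^{1/N}w^{1/N}$. Subscripts on operators indicate the tensor factors acted on ($A_2=\mathrm{id}\otimes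 A$ etc.; $O_{ij}$ means a two-factor operator $O$ applied with its first slot at factor $i$ and its second slot at factor $j$). A weight is a pair $\lambda=(x,y)\in\mathbb C^2$, non-singular if $x,y\neq0$. Product: $(x,y)(x',y')=(xx',yx'+y')$. For non-singular $\lambda=(x,y)$: $\lambda^*=(x^{-1},-yx^{-1})$ and $V_\lambda$ is $\mathbb C^N$ with $X$ acting by $x^{1/N}A$, $Y$ by $y^{1/N}B$. A sequence of non-singular weights $(\lambda_1,\dots,\lambda_n)$ is regular if $X,Y$ act invertibly on $V_{\lambda_i}\otimes\cdots\otimes V_{\lambda_j}$ for all $i\le j$ (equivalently all products $\lambda_i\cdots\lambda_j$ are non-singular). For a regular pair, $M^{\lambda\lambda'}_{\lambda,\lambda'}$ denotes $\mathbb C^N$ as a trivial representation. For $\mathbf a,\mathbf c\in\mathbb C$ with $\mathbf c^N-\mathbf a^N=1$ put $w(\mathbf a,\mathbf c|0)=1$, $w(\mathbf a,\mathbf c|n)=\prod_{j=1}^n(\mathbf c-\mathbf a q^{2j})^{-1}$ ($N$-periodic in $n$). For an operator $C$ with $C^N=\mathrm{id}$, $\Phi^q_{\mathbf a,\mathbf c}(C)$ acts on the $q^{2i}$-eigenspace of $C$ by $\zeta_{\mathbf a,\mathbf c}w(\mathbf a,\mathbf c|i)$, with $\zeta_{\mathbf a,\mathbf c}$ a fixed nonzero constant. For a regular pair $\lambda=(x,y),\lambda'=(x',y')$, $\mathbf F_{\lambda,\lambda'}=B_2^{-m_{x,x'}}\,\mathbf S\,\Phi^q_{\mathbf a,\mathbf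 c}(B_1A_2B_2^{-1})$, where $\mathbf S(e_i\otimes e_j)=e_i\otimes e_{i+j}$, $\mathbf a=-\frac{y^{1/N}(x')^{1/N}}{(yx'+y')^{1/N}}$, $\mathbf c=\frac{(y')^{1/N}}{(yx'+y')^{1/N}}$; it is a $\mathcal W$-isomorphism $V_\lambda\otimes V_{\lambda'}\to M^{\lambda\lambda'}_{\lambda,\lambda'}\otimes V_{\lambda\lambda'}$. For a regular triple, $\mathbf T_{\lambda,\lambda',\lambda''}: M^{\lambda\lambda'\lambda''}_{\lambda\lambda',\lambda''}\otimes M^{\lambda\lambda'}_{\lambda,\lambda'}\to M^{\lambda'\lambda''}_{\lambda',\lambda''}\otimes M^{\lambda\lambda'\lambda''}_{\lambda,\lambda'\lambda''}$ is the unique invertible linear map with $(\mathbf F_{\lambda,\lambda'\lambda''})_{13}(\mathbf F_{\lambda',\lambda''})_{23}(\mathbf F_{\lambda,\lambda'})_{12}^{-1}(\mathbf F_{\lambda\lambda',\lambda''})_{23}^{-1}=(\mathbf T_{\lambda,\lambda',\lambda''})_{21}$ on $\mathbb C^N\otimes\mathbb C^N\otimes\mathbb C^N$. For non-singular $\lambda=(x,y)$ define on $\mathbb C^N$: $C_\lambda e_i=q^{-2i\,m_{y,x^{-1}}}q^{-i(i-1)}e_{-i}$, $D_\lambda e_i=q^{-2i\,m_{y,x^{-1}}}q^{i(i-1)}e_{-i}$. For a regular pair let $I^{\lambda\lambda'}_{\lambda,\lambda'}:M^{\lambda\lambda'}_{\lambda,\lambda'}\to\mathrm{Hom}_{\mathcal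 W}(V_{\lambda\lambda'},V_\lambda\otimes V_{\lambda'})$ be the isomorphism $(I^{\lambda\lambda'}_{\lambda,\lambda'}f)(v)=\mathbf F^{-1}_{\lambda,\lambda'}(f\otimes v)$. Let $\mathbf A^{\mathrm{Hom}}:\mathrm{Hom}_{\mathcal W}(V_{\lambda\lambda'},V_\lambda\otimes V_{\lambda'})\to\mathrm{Hom}_{\mathcal W}(V_{\lambda^*},V_{\lambda'}\otimes V_{(\lambda\lambda')^*})$ be the isomorphism sending $f$ to the $g$ determined by $\sum_j e_j\otimes g(e_j)=(D_{\lambda^*}\otimes\mathrm{id}\otimes C_{\lambda\lambda'})\big(\sum_j f(e_j)\otimes e_j\big)$. Then $\mathbf A^{\lambda\lambda'}_{\lambda,\lambda'}:=(I^{\lambda^*}_{\lambda',(\lambda\lambda')^*})^{-1}\circ\mathbf A^{\mathrm{Hom}}\circ I^{\lambda\lambda'}_{\lambda,\lambda'}:M^{\lambda\lambda'}_{\lambda,\lambda'}\to M^{\lambda^*}_{\lambda',(\lambda\lambda')^*}$ (here $\lambda'(\lambda\lambda')^*=\lambda^*$). *)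

(* Defs.v *)
From mathcomp Require Import all_boot all_order all_algebra.
From mathcomp Require Import boolp classical_sets reals trigo.
From mathcomp Require Export complex mxtens.

Set Implicit Arguments.
Unset Strict Implicit.
Unset Printing Implicit Defensive.

Import Order.TTheory GRing.Theory Num.Theory.

Local Open Scope classical_set_scope.
Local Open Scope ring_scope.
Local Open Scope complex_scope.

(* Throughout, N is written n.+1, so that 'I_n.+1 carries the addition mod N.
   Linear maps are matrices acting on column vectors, and the tensor product is
   the Kronecker product *t, for which
   (delta_mx i 0) *t (delta_mx j 0) = delta_mx (mxtens_index (i, j)) 0. *)

Section Defs.

Context {R : realType} {n : nat}.

Local Notation C := R[i].
Local Notation N := n.+1.

Definition qN : C := cos (pi / N%:R) +i* sin (pi / N%:R).

(* A choice of N-th roots; the value at 0 is irrelevant. *)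
Definition root_choice (rt : C -> C) : Prop :=
  [/\ forall z, z != 0 -> rt z ^+ N = z,
      rt 1 = 1,
      forall z, z != 0 -> rt z^-1 = (rt z)^-1
    & forall z, z != 0 -> rt (- z) = - rt z].

Definition zeta_choice (zeta : C -> C -> C) : Prop :=
  forall a c, c ^+ N - a ^+ N = 1 -> zeta a c != 0.

Definition bvec (k : 'I_N) : 'cV[C]_N := delta_mx k 0.

Definition tensv (a b : nat) (u : 'cV[C]_a) (v : 'cV[C]_b) : 'cV[C]_(a * b) :=
  u *t v.

Definition opA : 'M[C]_N := \matrix_(i, k) (qN ^+ (2 * k) *+ (i == k)).
Definition opB : 'M[C]_N := \matrix_(i, k) (i == ordS k)%:R.

Definition opS : 'M[C]_(N * N) :=
  \matrix_(r, s) (let ij := mxtens_unindex s in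
                  r == mxtens_index (ij.1, ij.1 + ij.2))%:R.

Definition swap : 'M[C]_(N * N) :=
  \matrix_(r, s) (let ij := mxtens_unindex s in
                  r == mxtens_index (ij.2, ij.1))%:R.

Definition leg1 (O : 'M[C]_N) : 'M[C]_(N * N) := O *t 1%:M.
Definition leg2 (O : 'M[C]_N) : 'M[C]_(N * N) := 1%:M *t O.
Definition leg21 (O : 'M[C]_(N * N)) : 'M[C]_(N * N) := swap *m O *m swap.

Definition leg12_3 (O : 'M[C]_(N * N)) : 'M[C]_(N * N * N) := O *t 1%:M.
Definition leg23_3 (O : 'M[C]_(N * N)) : 'M[C]_(N * N * N) :=
  castmx (mulnA N N N, mulnA N N N) (1%:M *t O).
Definition leg13_3 (O : 'M[C]_(N * N)) : 'M[C]_(N * N * N) :=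
  leg23_3 swap *m leg12_3 O *m leg23_3 swap.

Definition weight : Type := (C * C)%type.
Definition nonsing (l : weight) : bool := (l.1 != 0) && (l.2 != 0).
Definition wmul (l l' : weight) : weight := (l.1 * l'.1, l.2 * l'.1 + l'.2).
Definition wdual (l : weight) : weight := (l.1^-1, - (l.2 / l.1)).

(* A representation of the Hopf algebra is given by the actions of X and Y. *)
Record wrep := WRep {
  wdim : nat;
  actX : 'M[C]_wdim;
  actY : 'M[C]_wdim }.

Definition wtens (U V : wrep) : wrep :=
  WRep (actX U *t actX V) (actY U *t actX V + 1%:M *t actY V).

Definition HomW (U V : wrep) : set 'M[C]_(wdim V, wdim U) :=
  [set f | f *m actX U = actX V *m f /\ f *m actY U = actY V *m f].
Arguments HomW : clear implicits.

Section Choices.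

Context (rt : C -> C) (zeta : C -> C -> C).

(* The default value ord0 is never reached for non-zero z and w. *)
Definition mexp (z w : C) : 'I_N :=
  odflt ord0 [pick m : 'I_N | rt (z * w) == qN ^+ (2 * m) * rt z * rt w].

Definition Vrep (l : weight) : wrep :=
  WRep (rt l.1 *: opA) (rt l.2 *: opB).

Fixpoint Vtens (l : weight) (s : seq weight) : wrep :=
  if s is l' :: s' then wtens (Vrep l) (Vtens l' s') else Vrep l.

Definition regular (s : seq weight) : Prop :=
  all nonsing s /\
  forall l t, infix (l :: t) s ->
    actX (Vtens l t) \in unitmx /\ actY (Vtens l t) \in unitmx.

Definition wfun (a c : C) (k : nat) : C :=
  \prod_(1 <= j < k.+1) (c - a * qN ^+ (2 * j))^-1.

(* "xget 0 P" is the chosen element of P, and 0 if P is empty; below, every P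
   is a singleton for the arguments of interest. *)
Definition Phi (d : nat) (a c : C) (O : 'M[C]_d) : 'M[C]_d :=
  xget 0 [set M | forall (i : 'I_N) (v : 'cV[C]_d),
    O *m v = qN ^+ (2 * i) *: v -> M *m v = (zeta a c * wfun a c i) *: v].

Definition Fmap (l l' : weight) : 'M[C]_(N * N) :=
  let r := rt (l.2 * l'.1 + l'.2) in
  let a := - (rt l.2 * rt l'.1 / r) in
  let c := rt l'.2 / r in
  leg2 (invmx opB ^+ mexp l.1 l'.1) *m opS
    *m Phi a c (leg1 opB *m leg2 opA *m leg2 (invmx opB)).

Definition Tmap (l l' l'' : weight) : 'M[C]_(N * N) :=
  xget 0 [set T | T \in unitmx /\
    leg13_3 (Fmap l (wmul l' l'')) *m leg23_3 (Fmap l' l'')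
      *m invmx (leg12_3 (Fmap l l')) *m invmx (leg23_3 (Fmap (wmul l l') l''))
    = leg12_3 (leg21 T)].

Definition Cmap (l : weight) : 'M[C]_N :=
  \matrix_(r, i) ((qN ^- (2 * i * mexp l.2 l.1^-1) * qN ^- (i * i.-1))
                    *+ (r == - i)).
Definition Dmap (l : weight) : 'M[C]_N :=
  \matrix_(r, i) ((qN ^- (2 * i * mexp l.2 l.1^-1) * qN ^+ (i * i.-1))
                    *+ (r == - i)).

Definition Imap (l l' : weight) (f : 'cV[C]_N) : 'M[C]_(N * N, N) :=
  \matrix_(p, k) (invmx (Fmap l l') *m tensv f (bvec k)) p 0.

Definition Iinv (l l' : weight) (g : 'M[C]_(N * N, N)) : 'cV[C]_N :=
  xget 0 [set f | Imap l l' f = g].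

Definition AHom (l l' : weight) (f : 'M[C]_(N * N, N)) : 'M[C]_(N * N, N) :=
  xget 0 [set g |
    HomW (Vrep (wdual l)) (wtens (Vrep l') (Vrep (wdual (wmul l l')))) g /\
    castmx (mulnA N N N, erefl 1%N) (\sum_j tensv (bvec j) (g *m bvec j))
    = (Dmap (wdual l) *t 1%:M *t Cmap (wmul l l'))
        *m \sum_j tensv (f *m bvec j) (bvec j)].

(* The matrix of the composite of Imap, AHom and the inverse of the Imap of the
   target. *)
Definition Amap (l l' : weight) : 'M[C]_N :=
  \matrix_(i, k)
    (Iinv l' (wdual (wmul l l')) (AHom l l' (Imap l l' (bvec k)))) i 0.

End Choices.

End Defs.

Arguments qN R n : clear implicits.
Arguments root_choice R n rt : clear implicits.
Arguments zeta_choice R n zeta : clear implicits.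
Arguments weight R : clear implicits.
Arguments regular {R} n rt s.
Arguments mexp {R} n rt z w.
Arguments Tmap {R} n rt zeta l l' l''.
Arguments Amap {R} n rt zeta l l'.

(* Main.v *)
Require Import Defs.
From mathcomp Require Import all_boot all_order all_algebra.
From mathcomp Require Import reals.
From mathcomp Require Import boolp classical_sets trigo.
From mathcomp Require Import ring lra zify.

(** Write [J k a b c] for the matrix entries of the basis [I (e_k)] of
    Hom (V_ll', V_l (x) V_l').  The relation defining [T] says that the two ways
    of composing such vertices into maps V_0 -> V_1 (x) V_2 (x) V_3 agree up
    to [T].  The map [A] rotates a vertex: the rotated tensor is
    [D(-a) C(-c) J k (-a) b (-c)] with explicit coefficients of C and D.
    Contracting rotated vertices along a common edge leaves a factor q^(2a)
    on that edge, from D_{l^*}^T D_l^{-1} on one side and C_{l^*}^{-T} C_l on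
    the other; it is the action of X up to scalar, so X-equivariance of the
    vertex moves it to the outer edges, at the price of q^(2 m_{x1,x2}) on
    one side and q^(2 m_{x1,x2x3}) on the other.  What remains is the relation
    defining T for (l1, l2, l3), contracted with nonzero coefficients.
    The vertices span the Hom spaces because the matrices A and B have only
    scalar commutant. *)

Set Implicit Arguments.
Unset Strict Implicit.
Unset Printing Implicit Defensive.

Import Order.TTheory GRing.Theory Num.Theory.

Local Open Scope ring_scope.
Local Open Scope complex_scope.

(** Neither T nor A has a closed formula here: both are known only through what they do to vertices,
    so the identity is tested on rows of glued vertex pairs that separate matrices. On such rows T
    reglues and A rotates, and the inverse of A is the rotation read backwards, which brings back
    the original vertices because the dual of the dual is the weight itself. The two exponents of q
    differ because the contracted edge l4 is the output of the vertex (l1, l2), whereas the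
    contracted edge l5 is the second factor of the vertex (l1, l5). The outer edges l0 and l2^* are
    rotated by C on one side and by D on the other. Their contributions agree because q^(i(i-1))
    changes by exactly q^(2i) under i -> -i; for this function to be well defined modulo N, N must
    be odd. *)

Local Notation idx a b := (mxtens_index (a, b)).

(** * Roots of unity and Gaussian weights *)

Section RootsOfUnity.

Context {R : realType} {n : nat}.
Local Notation C := R[i].
Local Notation N := n.+1.
Local Notation q := (qN R n).

Lemma qN_exp k : q ^+ k = cos (k%:R * (pi / N%:R)) +i* sin (k%:R * (pi / N%:R)).
Proof.
elim: k => [|k IHk]; first by rewrite expr0 mul0r cos0 sin0.
have -> : k.+1%:R * (pi / N%:R) = k%:R * (pi / N%:R) + pi / N%:R :> R.
  by rewrite -(natr1 k) mulrDl mul1r.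
rewrite exprSr IHk cosD sinD /qN.
apply/eqP; rewrite eq_complex /=; apply/andP; split; apply/eqP; ring.
Qed.

Lemma qN_period : q ^+ (2 * N) = 1.
Proof.
rewrite qN_exp natrM -mulrA [N%:R * _]mulrC divfK ?pnatr_eq0 //.
by rewrite mulr_natl cos2pi sin2pi.
Qed.

(** For 0 < k < N the real part of q^(2k) is 1 - 2 sin^2(k pi / N) < 1. *)
Lemma qN_prim : N.-primitive_root (q ^+ 2).
Proof.
apply/andP; split=> //; apply/forallP=> i; rewrite unity_rootE -exprM.
apply/eqP; have [iN|iN] := eqVneq i.+1 N; first by rewrite iN qN_period eqxx.
apply/negbTE; have lt_iN : (i.+1 < N)%N by rewrite ltn_neqAle iN /=.
set t := i.+1%:R * (pi / N%:R) : R.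
have t_gt0 : 0 < t by rewrite !mulr_gt0 ?invr_gt0 ?ltr0n ?pi_gt0.
have t_ltpi : t < pi.
  rewrite /t mulrCA -ltr_pdivlMl ?pi_gt0 // mulVf ?gt_eqF ?pi_gt0 //.
  by rewrite ltr_pdivrMr ?ltr0n // mul1r ltr_nat.
have sin_t : 0 < sin t by apply: sin_gt0_pi; rewrite ?in_itv /= t_gt0.
rewrite qN_exp natrM -mulrA -/t mulr_natl mulr2n eq_complex negb_and /=.
by rewrite sinD cosD; apply/orP; left; have := cos2Dsin2 t; nra.
Qed.

Lemma qN_neq0 : q != 0.
Proof. by apply/eqP=> q0; have := oner_neq0 C; rewrite -qN_period q0 expr0n /= eqxx. Qed.

Lemma qN_exp_neq0 k : q ^+ k != 0.
Proof. by rewrite expf_neq0 ?qN_neq0. Qed.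

Lemma qN_exp_mod a b : a = b %[mod 2 * N] -> q ^+ a = q ^+ b.
Proof. by move=> eq_ab; rewrite -(expr_mod a qN_period) eq_ab expr_mod ?qN_period. Qed.

Definition chi (i : 'I_N) : C := q ^+ (2 * i).
(** The exponent is computed in [nat] on the representative of i; the truncation of [i.-1] at 0 is
    absorbed by the factor i. *)
Definition gauss (i : 'I_N) : C := q ^+ (i * i.-1).
Definition ord_one : 'I_N := inZp 1.

Lemma ordSE (i : 'I_N) : ordS i = i + ord_one.
Proof. by apply: val_inj; rewrite /= modnDmr addn1. Qed.

Lemma chiD i j : chi (i + j) = chi i * chi j.
Proof.
rewrite /chi -exprD; apply: qN_exp_mod; rewrite -mulnDr -!muln_modr.
by congr (2 * _)%N; rewrite /= modn_mod.
Qed.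

Lemma chi0 : chi 0 = 1. Proof. by []. Qed.

Lemma chi_neq0 i : chi i != 0. Proof. exact: qN_exp_neq0. Qed.

Lemma chiN i : chi (- i) = (chi i)^-1.
Proof.
by apply: (mulfI (chi_neq0 i)); rewrite divff ?chi_neq0 // -chiD subrr.
Qed.

Lemma chi1 : chi ord_one = q ^+ 2.
Proof. by apply: qN_exp_mod; rewrite -[RHS]/((2 * 1) %% _)%N -!muln_modr modn_mod. Qed.

Lemma chi_inj : injective chi.
Proof.
move=> i j /eqP; rewrite /chi !exprM (eq_prim_root_expr qN_prim) !modn_small //.
by move/eqP; apply: val_inj.
Qed.

Lemma gauss_neq0 i : gauss i != 0. Proof. exact: qN_exp_neq0. Qed.

Hypothesis n_odd : odd N.

(** Without wrap-around this is (i+1) i = i (i-1) + 2i. At i = N-1 the exponent N (N-1) must vanish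
    modulo 2N, which holds as N is odd. *)
Lemma gaussD1 i : gauss (i + ord_one) = gauss i * chi i.
Proof.
rewrite -ordSE /gauss /chi -exprD; apply: qN_exp_mod => /=.
have [lt_iN|] := ltnP i.+1 N.
  by rewrite (modn_small lt_iN); congr (_ %% _)%N; case: (nat_of_ord i) => [|k] /=; lia.
move=> le_Ni; have iE : i = n :> nat by have := ltn_ord i; lia.
rewrite iE modnn mod0n; apply/esym/eqP; rewrite -/(dvdn _ _).
have -> : (n * n.-1 + 2 * n = 2 * N * n./2)%N.
  have := odd_double_half n; have := n_odd; rewrite /= => /negbTE ->.
  by move: (n./2) => [|h] <- //=; nia.
exact: dvdn_mulr.
Qed.

(** The exponents (N-i)(N-i-1) and i(i+1) differ by N (N-2i-1), a multiple of 2N for odd N. The sign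
    of N-2i-1 decides which of the two is larger in [nat], hence the two cases. *)
Lemma gaussN i : gauss (- i) = gauss i * chi i.
Proof.
have [->|i_neq0] := eqVneq i 0; first by rewrite oppr0 chi0 mulr1.
have i_gt0 : (0 < i)%N by rewrite lt0n.
rewrite /gauss /chi -exprD; apply: qN_exp_mod => /=.
have lt_iN := ltn_ord i; rewrite (@modn_small (N - i)); last by lia.
have := odd_double_half n; have := n_odd; rewrite /= => /negbTE -> nE.
move: i_gt0 lt_iN; move: (nat_of_ord i) => k k_gt0 lt_kN.
have kE : (k * k.-1 + 2 * k = k * k.+1)%N by case: k k_gt0 {lt_kN} => // k _ /=; lia.
rewrite {}kE; have [d dE] : exists d, (N - k)%N = d.+1 by exists (N - k).-1; lia.
rewrite dE /=; have [le_kd|lt_dk] := leqP k d.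
  have [e eE] : exists e, d = (k + e.*2)%N by exists (n./2 - k)%N; lia.
  have -> : (d.+1 * d = e * (2 * N) + k * k.+1)%N.
    have -> : N = (2 * k + e.*2).+1 by lia.
    by rewrite eE -mul2n; ring.
  by rewrite modnMDl.
have [e eE] : exists e, k = (d + e.*2)%N by exists (k - n./2)%N; lia.
have -> : (k * k.+1 = e * (2 * N) + d.+1 * d)%N.
  have -> : N = (2 * d + e.*2).+1 by lia.
  by rewrite eE -mul2n; ring.
by rewrite modnMDl.
Qed.

End RootsOfUnity.

(** * Tensor products of matrices and q-commutation *)

Section Tensor.

Context {K : comPzRingType}.

Lemma eq_idx m p (a c : 'I_m) (b d : 'I_p) :
  (idx a b == idx c d) = (a == c) && (b == d).
Proof. by rewrite (inj_eq (can_inj (@mxtens_indexK m p))). Qed.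

Lemma sum_idx m p (F : 'I_(m * p) -> K) :
  \sum_r F r = \sum_a \sum_b F (idx a b).
Proof.
rewrite pair_big /= (reindex (@mxtens_index m p)) /=.
  by apply: eq_bigr => -[].
by exists (@mxtens_unindex m p) => ? _; rewrite (mxtens_indexK, mxtens_unindexK).
Qed.

Lemma tens11 m p : (1%:M : 'M[K]_m) *t (1%:M : 'M[K]_p) = 1%:M.
Proof.
apply/matrixP=> r s; case: (mxtens_indexP r) => a b; case: (mxtens_indexP s) => c d.
by rewrite tensmxE !mxE eq_idx -mulnb natrM.
Qed.

Context {m p r s : nat}.
Implicit Types (A : 'M[K]_(m, p)) (B : 'M[K]_(r, s)).

Lemma tensmxDl A A' B : (A + A') *t B = A *t B + A' *t B.
Proof. by apply/matrixP=> i j; rewrite !mxE mulrDl. Qed.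

Lemma tensmxDr A B B' : A *t (B + B') = A *t B + A *t B'.
Proof. by apply/matrixP=> i j; rewrite !mxE mulrDr. Qed.

Lemma tensmxZl k A B : (k *: A) *t B = k *: (A *t B).
Proof. by apply/matrixP=> i j; rewrite !mxE mulrA. Qed.

Lemma tensmxZr k A B : A *t (k *: B) = k *: (A *t B).
Proof. by apply/matrixP=> i j; rewrite !mxE mulrCA. Qed.

End Tensor.

Lemma tensmx_exp (K : comPzRingType) m p (A : 'M[K]_m) (B : 'M[K]_p) k :
  (A *t B) ^+ k = A ^+ k *t B ^+ k.
Proof.
elim: k => [|k IHk]; first by rewrite !expr0; exact/esym/tens11.
by rewrite !exprS IHk -!mulmxE tensmx_mul.
Qed.

Section QCommutation.

Context {K : fieldType} {d : nat}.
Implicit Types (P Q U : 'M[K]_d) (c : K).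

Lemma qcomm_expr P Q c k :
  P *m Q = c *: (Q *m P) -> P *m Q ^+ k = c ^+ k *: (Q ^+ k *m P).
Proof.
move=> PQ; elim: k => [|k IHk]; first by rewrite !expr0 scale1r mulmx1 mul1mx.
rewrite !exprS -!mulmxE mulmxA PQ -scalemxAl -mulmxA IHk -scalemxAr scalerA.
by rewrite mulmxA.
Qed.

Lemma qcomm_expl P Q c k :
  P *m Q = c *: (Q *m P) -> P ^+ k *m Q = c ^+ k *: (Q *m P ^+ k).
Proof.
move=> PQ; elim: k => [|k IHk]; first by rewrite !expr0 scale1r mulmx1 mul1mx.
rewrite exprS -mulmxE -mulmxA IHk -scalemxAr (mulmxA P) PQ -scalemxAl scalerA.
by rewrite -mulmxA -exprSr.
Qed.

Lemma qcomm_exprMn P Q c k :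
  P *m Q = c *: (Q *m P) -> (Q *m P) ^+ k = c ^+ 'C(k, 2) *: (Q ^+ k *m P ^+ k).
Proof.
move=> PQ; elim: k => [|k IHk]; first by rewrite !expr0 scale1r mulmx1.
rewrite exprS IHk -mulmxE -scalemxAr mulmxA -(mulmxA Q) (qcomm_expr _ PQ).
rewrite -scalemxAr -scalemxAl scalerA -exprD !mulmxA.
rewrite mulmxE -exprS -mulrA -exprS; congr (_ ^+ _ *: _).
by rewrite binS bin1 addnC.
Qed.

End QCommutation.

(** * Products over roots of unity and N-th powers of q-commuting sums *)

Section RootOfUnityProducts.

Context {K : fieldType} {N : nat} {z : K}.
Hypothesis z_prim : N.-primitive_root z.

Lemma prim_root_neq0 : z != 0.
Proof. by rewrite (prim_root_eq0 z_prim) -lt0n (prim_order_gt0 z_prim). Qed.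

Lemma prim_root_bin2 : odd N -> z ^+ 'C(N, 2) = 1.
Proof. by move=> N_odd; rewrite bin2odd // exprM (prim_expr_order z_prim) expr1n. Qed.

Lemma prod_sub_prim_root (a c : K) :
  a != 0 -> \prod_(0 <= j < N) (c - a * z ^+ j) = c ^+ N - a ^+ N.
Proof.
move=> a_neq0.
have /(congr1 (fun p => a ^+ N * p.[c / a])) := factor_Xn_sub_1 z_prim.
rewrite horner_prod hornerD hornerN hornerXn hornerC mulrBr mulr1 expr_div_n.
rewrite mulrCA divff ?expf_neq0 // mulr1 => <-.
have -> : a ^+ N = \prod_(0 <= j < N) a by rewrite prodr_const_nat subn0.
rewrite -big_split /=; apply: eq_bigr => j _.
by rewrite hornerXsubC mulrBr mulrCA divff // mulr1.
Qed.

Lemma prod_one_sub_prim_root :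
  \prod_(0 <= j < N) (1 - (z ^- j) *: 'X) = 1 - 'X^N :> {poly K}.
Proof.
have z_neq0 j : z ^+ j != 0 by rewrite expf_neq0 ?prim_root_neq0.
have zj j : 1 - (z ^- j) *: 'X = (- z ^- j)%:P * ('X - (z ^+ j)%:P) :> {poly K}.
  rewrite mulrBr -polyCM mulNr mulVf // !polyCN opprK mulNr mul_polyC.
  by rewrite polyC1 addrC.
rewrite (eq_bigr _ (fun j _ => zj j)) big_split /= (factor_Xn_sub_1 z_prim).
rewrite -(rmorph_prod (polyC (R := K))).
(* Evaluating the factorization of X^N - 1 at 0 gives the product of the - z^j, and its value -1 is
   its own inverse. *)
suff -> : \prod_(0 <= j < N) - z ^- j = -1 by rewrite rmorphN rmorph1 mulN1r opprB.
have /(congr1 (horner^~ 0)) := factor_Xn_sub_1 z_prim.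
rewrite horner_prod hornerD hornerN hornerXn hornerC expr0n.
rewrite gtn_eqF ?(prim_order_gt0 z_prim) // add0r => prodN1.
rewrite -[RHS]invrN1 -prodN1 -prodfV; apply: eq_bigr => j _.
by rewrite hornerXsubC sub0r invrN.
Qed.

Context {d : nat}.
Implicit Types P Q : 'M[K]_d.

(** The mixed terms of the q-binomial expansion vanish at a root of unity. This makes the N-th power
    of Y on a tensor product a scalar. *)
Lemma qcomm_exprDn P Q :
    odd N -> P *m Q = z *: (Q *m P) -> P \in unitmx ->
  (P + Q) ^+ N = P ^+ N + Q ^+ N.
Proof.
case: d P Q => [|d'] P Q N_odd PQ P_unit; first by rewrite [LHS]flatmx0 [RHS]flatmx0.
have z_neq0 : z != 0 by rewrite prim_root_neq0.
(* P + Q = P (1 - V) with V P = z^-1 P V, hence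
   (P + Q)^N = P^N * \prod_j (1 - z^-j V) = P^N (1 - V^N). *)
set W := invmx P *m Q; set V := - W.
have QW : Q *m invmx P = z *: W.
  by rewrite /W -[Q in LHS](mulKmx P_unit) PQ -!scalemxAr -scalemxAl mulmxA mulmxK.
have VP : V *m P = z^-1 *: (P *m V).
  rewrite /V /W mulNmx mulmxN mulKVmx // -mulmxA.
  rewrite -[Q *m P](scalerK z_neq0) -PQ -scalemxAr mulKmx //.
  by rewrite scalerN.
have PDQ : P + Q = P *m (1 - V).
  by rewrite opprK mulmxDr mulmxA mulmxV // mul1mx mulmxE mulr1.
have expk k : (P *m (1 - V)) ^+ k
    = P ^+ k *m horner_mx V (\prod_(0 <= j < k) (1 - (z ^- j) *: 'X)).
  elim: k => [|k IHk]; first by rewrite big_nil rmorph1 !expr0 mulmxE mulr1.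
  rewrite exprS IHk -mulmxE -!mulmxA (mulmxA (1 - V)) (mulmxBl 1 V) (qcomm_expr k VP).
  rewrite exprS -mulmxE -mulmxA; congr (P *m _).
  rewrite big_nat_recr //= 1?mulrC // rmorphM rmorphB rmorph1 /= horner_mxZ horner_mx_X.
  by rewrite -!mulmxE mulmxA mulmxBr scalemxAr exprVn mulmxE mulr1 mul1r.
rewrite PDQ expk prod_one_sub_prim_root rmorphB rmorph1 rmorphXn /= horner_mx_X.
rewrite mulmxBr mulmxE mulr1; congr (_ + _).
(* Oddness of N enters twice: in the sign (-W)^N = - W^N, and in z^'C(N, 2) = 1, which reduces W^N
   to P^-N Q^N. *)
rewrite /V exprNn -signr_odd N_odd expr1 mulN1r mulrN opprK /W.
rewrite (qcomm_exprMn N QW) prim_root_bin2 // scale1r -mulmxE mulmxA.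
suff -> : P ^+ N *m invmx P ^+ N = 1%:M by rewrite mul1mx.
have -> : invmx P ^+ N = P ^- N by exact: exprVn.
by rewrite mulmxE divrr ?unitrX.
Qed.

End RootOfUnityProducts.

(** * Clock and shift matrices; regular sequences *)

Section UnitPowers.

Context {K : fieldType} {d : nat}.

Lemma tens_scalar m p (a b : K) :
  (a%:M : 'M_m) *t (b%:M : 'M_p) = (a * b)%:M.
Proof.
by rewrite -[a%:M]scalemx1 -[b%:M]scalemx1 tensmxZl tensmxZr tens11 scalerA scalemx1.
Qed.

Lemma scalar_exp_unit (M : 'M[K]_d) k c :
  (0 < k)%N -> M ^+ k = c%:M -> c != 0 -> M \in unitmx.
Proof.
case: k => // k _ Mk c_neq0; have [|//] := @mulmx1_unit _ _ M (c^-1 *: M ^+ k).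
by rewrite -scalemxAr mulmxE -exprS Mk scale_scalar_mx mulVf.
Qed.

Lemma unit_scalar_exp (M : 'M[K]_d) k c :
  (0 < d)%N -> M ^+ k = c%:M -> M \in unitmx -> c != 0.
Proof.
case: d M => // d' M _ Mk M_unit; apply: contraTneq (unitrX k M_unit) => c0.
by rewrite Mk c0 raddf0 unitr0.
Qed.

End UnitPowers.

Section ClockShift.

Context {R : realType} {n : nat}.
Local Notation C := R[i].
Local Notation N := n.+1.
Local Notation q := (qN R n).
Local Notation A := (@opA R n).
Local Notation B := (@opB R n).

Lemma mul_opA p (M : 'M[C]_(N, p)) i j : (A *m M) i j = chi i * M i j.
Proof.
rewrite mxE (bigD1 i) //= big1 ?addr0 ?mxE ?eqxx // => k /negbTE ki.
by rewrite mxE eq_sym ki mulr0n mul0r.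
Qed.

Lemma mul_mx_opA p (M : 'M[C]_(p, N)) i j : (M *m A) i j = M i j * chi j.
Proof.
rewrite mxE (bigD1 j) //= big1 ?addr0 ?mxE ?eqxx // => k /negbTE ki.
by rewrite mxE ki mulr0n mulr0.
Qed.

Lemma mul_opB p (M : 'M[C]_(N, p)) i j : (B *m M) i j = M (i - ord_one) j.
Proof.
rewrite mxE (bigD1 (i - ord_one)) //= big1 ?addr0.
  by rewrite mxE ordSE subrK eqxx mul1r.
by move=> k /negbTE ki; rewrite mxE ordSE -subr_eq eq_sym ki mul0r.
Qed.

Lemma mul_mx_opB p (M : 'M[C]_(p, N)) i j : (M *m B) i j = M i (j + ord_one).
Proof.
rewrite mxE (bigD1 (j + ord_one)) //= big1 ?addr0.
  by rewrite mxE ordSE eqxx mulr1.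
by move=> k /negbTE ki; rewrite mxE ordSE ki mulr0.
Qed.

Lemma opA_opB : A *m B = q ^+ 2 *: (B *m A).
Proof.
apply/matrixP=> i j; rewrite mul_opA [RHS]mxE mul_mx_opA !mxE ordSE.
by case: eqP => [->|]; rewrite ?mulr0 ?mul0r ?mulr0 // chiD chi1; ring.
Qed.

Lemma opA_exp : A ^+ N = 1.
Proof.
suff Ak k : A ^+ k = \matrix_(i, j) (chi i ^+ k *+ (i == j)).
  by rewrite Ak; apply/matrixP=> i j; rewrite !mxE /chi exprM exprAC
    (prim_expr_order qN_prim) expr1n.
elim: k => [|k IHk]; first by apply/matrixP=> i j; rewrite !mxE expr0.
apply/matrixP=> i j; rewrite exprS -mulmxE mul_opA IHk !mxE exprS.
by rewrite mulrnAr.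
Qed.

Lemma opB_exp : B ^+ N = 1.
Proof.
suff Bk k : B ^+ k = \matrix_(i, j) (i == j + ord_one *+ k)%:R.
  rewrite Bk; apply/matrixP=> i j; rewrite !mxE.
  suff -> : (ord_one *+ N : 'I_N) = 0 by rewrite addr0.
  by rewrite Zp_mulrn; apply: val_inj; rewrite /= modnMl.
elim: k => [|k IHk]; first by apply/matrixP=> i j; rewrite !mxE mulr0n addr0.
apply/matrixP=> i j; rewrite exprS -mulmxE mul_opB IHk !mxE.
by rewrite subr_eq -addrA -mulrSr.
Qed.

Lemma opB_unit : B \in unitmx.
Proof. by apply: (scalar_exp_unit _ opB_exp); rewrite ?oner_eq0. Qed.

End ClockShift.

Section Regular.

Context {R : realType} {n : nat}.
Local Notation C := R[i].
Local Notation N := n.+1.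
Local Notation q := (qN R n).
Local Notation A := (@opA R n).
Local Notation B := (@opB R n).
Hypothesis n_odd : odd N.
Context {rt : C -> C}.
Hypothesis rtP : root_choice R n rt.

(** Bracketed to the right, like [Vtens]. *)
Fixpoint wprod (l : weight R) (s : seq (weight R)) : weight R :=
  if s is l' :: s' then wmul l (wprod l' s') else l.

Lemma rtX z : z != 0 -> rt z ^+ N = z. Proof. by case: rtP => h _ _ _; apply: h. Qed.

Lemma rt_neq0 z : z != 0 -> rt z != 0.
Proof. by move=> z0; have := z0; rewrite -{1}(rtX z0) expf_eq0. Qed.

Lemma wdim_Vtens l s : (0 < wdim (Vtens (n := n) rt l s))%N.
Proof. by elim: s l => [|l' s IHs] l //=; rewrite muln_gt0 IHs. Qed.

(** The two summands of the coproduct of Y q-commute, so Y^N maps to Y^N (x) X^N + 1 (x) Y^N: this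
    is the second component of the product of weights. The relation between X and Y and the
    nonvanishing of the first component are carried through the induction because the binomial
    formula asks for them. *)
Lemma Vtens_exp l s (V := Vtens (n := n) rt l s) : all (@nonsing R) (l :: s) ->
  [/\ actX V ^+ N = (wprod l s).1%:M, (wprod l s).1 != 0,
      actY V ^+ N = (wprod l s).2%:M
    & actX V *m actY V = q ^+ 2 *: (actY V *m actX V)].
Proof.
rewrite {}/V; elim: s l => [|l' s IHs] l.
  rewrite /= andbT => /andP[x0 y0]; split=> //.
  - by rewrite exprZn opA_exp rtX // scalemx1.
  - by rewrite exprZn opB_exp rtX // scalemx1.
  rewrite -!(scalemxAl, scalemxAr) opA_opB !scalerA; congr (_ *: _); ring.
move=> /andP[/andP[x0 y0] /IHs] /=; move: (wprod l' s) => m.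
set V := Vtens _ _ _; move=> [Xm m0 Ym XY].
have XN : (rt l.1 *: A *t actX V) ^+ N = (l.1 * m.1)%:M.
  by rewrite tensmx_exp Xm exprZn opA_exp rtX // scalemx1 tens_scalar.
have PN : (rt l.2 *: B *t actX V) ^+ N = (l.2 * m.1)%:M.
  by rewrite tensmx_exp Xm exprZn opB_exp rtX // scalemx1 tens_scalar.
split; rewrite ?mulf_neq0 //.
  rewrite (qcomm_exprDn qN_prim) //.
  - rewrite PN tensmx_exp expr1n Ym.
    by rewrite -[1]/(1%:M) tens_scalar mul1r -raddfD.
  - by rewrite !tensmx_mul mulmx1 mul1mx XY tensmxZr.
  by apply: (scalar_exp_unit _ PN); rewrite // mulf_neq0.
rewrite mulmxDr mulmxDl scalerDr !tensmx_mul mulmx1 mul1mx XY tensmxZr.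
congr (_ + _); rewrite -!scalemxAl -!scalemxAr opA_opB !tensmxZl !scalerA.
by congr (_ *: _); ring.
Qed.

(** A matrix whose N-th power is a scalar is invertible exactly when that scalar is nonzero. First
    components are products of nonzero numbers, so only the second ones give a condition. *)
Lemma regularP s : regular n rt s <->
  all (@nonsing R) s /\ forall l t, infix (l :: t) s -> (wprod l t).2 != 0.
Proof.
split=> -[s_ns sP]; split=> // l t lt_s; have /sP := lt_s.
  move=> [_ Y_unit].
  have [|_ _ Yexp _] := @Vtens_exp l t.
    by apply/allP=> m /(mem_infix lt_s); apply/allP.
  exact: (unit_scalar_exp (wdim_Vtens l t) Yexp).
move=> y0; have [|Xexp x0 Yexp _] := @Vtens_exp l t.
  by apply/allP=> m /(mem_infix lt_s); apply/allP.
by split; [apply: (scalar_exp_unit _ Xexp) | apply: (scalar_exp_unit _ Yexp)].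
Qed.

End Regular.

(** * Functions of an operator of finite order *)

Lemma scalemx_exp (K : comPzRingType) m (a : K) (M : 'M[K]_m) k :
  (a *: M) ^+ k = a ^+ k *: M ^+ k.
Proof.
elim: k => [|k IHk]; first by rewrite !expr0 scale1r.
by rewrite !exprS IHk -!mulmxE -scalemxAl -scalemxAr scalerA.
Qed.

Section Spectral.

Context {R : realType} {n d : nat}.
Local Notation C := R[i].
Local Notation N := n.+1.
Local Notation q := (qN R n).
Context {O : 'M[C]_d}.
Hypothesis O_exp : O ^+ N = 1%:M.

(** The Fourier average over Z/N, an explicit polynomial in O. *)
Definition eigenproj (i : 'I_N) : 'M[C]_d :=
  N%:R^-1 *: \sum_(k < N) ((chi i)^-1 *: O) ^+ k.

Lemma sum_unity_root (z : C) :
  z ^+ N = 1 -> \sum_(k < N) z ^+ k = (if z == 1 then N%:R else 0).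
Proof.
move=> zN; case: eqP => [->|/eqP z_neq1].
  under eq_bigr do rewrite expr1n.
  by rewrite sumr_const card_ord.
by apply: (mulfI (x := z - 1)); rewrite ?subr_eq0 // mulr0 -subrX1 zN subrr.
Qed.

Lemma chi_expN (i : 'I_N) : (chi i : C) ^+ N = 1.
Proof. by rewrite /chi exprM exprAC (prim_expr_order qN_prim) expr1n. Qed.

Lemma eigenproj_eigen i (M : 'M[C]_(d, 1)) :
  O *m (eigenproj i *m M) = chi i *: (eigenproj i *m M).
Proof.
suff OP : O *m eigenproj i = chi i *: eigenproj i by rewrite mulmxA OP scalemxAl.
set V := (chi i)^-1 *: O; have -> : O = chi i *: V.
  by rewrite scalerA divff ?chi_neq0 // scale1r.
rewrite /eigenproj -/V -scalemxAl; congr (_ *: _); rewrite -scalemxAr; congr (_ *: _).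
apply/eqP; rewrite -subr_eq0 -[X in _ - X]mul1r -mulmxE -mulmxBl mulmxE -subrX1.
by rewrite scalemx_exp O_exp exprVn chi_expN invr1 scale1r subrr.
Qed.

Lemma eigenproj_delta i j (v : 'cV[C]_d) :
  O *m v = chi i *: v -> eigenproj j *m v = (i == j)%:R *: v.
Proof.
move=> Ov; have Okv k : ((chi j)^-1 *: O) ^+ k *m v = (chi i / chi j) ^+ k *: v.
  elim: k => [|k IHk]; first by rewrite !expr0 scale1r mul1mx.
  rewrite !exprS -mulmxE -mulmxA IHk -scalemxAr -scalemxAl Ov !scalerA.
  by congr (_ *: _); ring.
rewrite /eigenproj -scalemxAl mulmx_suml; under eq_bigr do rewrite Okv.
rewrite -scaler_suml sum_unity_root; last by rewrite expr_div_n !chi_expN divr1.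
have -> : (chi i / chi j == 1 :> C) = (i == j).
  apply/eqP/eqP => [ij|->]; last by rewrite divff ?chi_neq0.
  by apply: (@chi_inj R); rewrite -[LHS](divfK (chi_neq0 j)) ij mul1r.
rewrite scalerA; case: eqP; rewrite ?mulr0 // => _.
by rewrite mulVf // (prim_root_natf_neq0 qN_prim).
Qed.

Lemma sum_eigenproj : \sum_j eigenproj j = 1%:M.
Proof.
have sumk (k : 'I_N) :
    \sum_(j : 'I_N) ((chi j)^-1 *: O) ^+ k = (N%:R *+ (k == 0)) *: O ^+ k.
  under eq_bigr => j _.
    have -> : ((chi j)^-1 *: O) ^+ k = (q ^+ 2 ^- k) ^+ j *: O ^+ k.
      by rewrite scalemx_exp /chi !exprVn exprM (exprAC (q ^+ 2)).
    over.
  rewrite -scaler_suml sum_unity_root; last first.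
    by rewrite exprVn (exprAC (q ^+ 2)) (prim_expr_order qN_prim) expr1n invr1.
  rewrite invr_eq1 -(prim_order_dvd qN_prim).
  suff -> : (N %| k)%N = (k == 0) by case: eqP; rewrite ?mulr1n ?mulr0n.
  by rewrite -val_eqE /= /dvdn modn_small.
rewrite -scaler_sumr exchange_big /= (eq_bigr _ (fun k _ => sumk k)).
rewrite (bigD1 0) //= big1 => [|k /negbTE ->]; last by rewrite mulr0n scale0r.
rewrite addr0 expr0 scalerA mulVf ?scale1r //.
exact: (prim_root_natf_neq0 qN_prim).
Qed.

(** The eigenprojections sum to the identity, so eigenvectors of O determine a matrix. [Phi] is
    specified on eigenvectors only, and its properties are checked there. *)
Lemma eigen_ext e (M M' : 'M[C]_(e, d)) :
    (forall (i : 'I_N) (v : 'cV_d), O *m v = chi i *: v -> M *m v = M' *m v) ->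
  M = M'.
Proof.
move=> MM'; rewrite -[LHS]mulmx1 -[RHS]mulmx1 -sum_eigenproj !mulmx_sumr.
apply: eq_bigr => i _; apply/matrixP => r k.
have /matrixP/(_ r 0) := MM' i _ (eigenproj_eigen i (delta_mx k 0)).
by rewrite !mulmxA -!colE !mxE.
Qed.

Context {zeta : C -> C -> C} {a c : C}.
Local Notation phi := (@Phi R n zeta d a c O).

Lemma Phi_eigen (i : 'I_N) (v : 'cV[C]_d) :
  O *m v = chi i *: v -> phi *m v = (zeta a c * wfun (n := n) a c i) *: v.
Proof.
pose P := [set M : 'M[C]_d | forall (i : 'I_N) (v : 'cV[C]_d),
  O *m v = q ^+ (2 * i) *: v -> M *m v = (zeta a c * wfun (n := n) a c i) *: v]%classic.
suff : P phi by apply.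
rewrite /Phi -/P; apply: xgetPex;
(* The spectral sum shows that the set from which [xget] chooses is not empty. *)
exists (\sum_(j < N) (zeta a c * wfun (n := n) a c j) *: eigenproj j).
move=> {v}i v Ov.
rewrite mulmx_suml (bigD1 i) //= big1 => [|j /negbTE ji].
  by rewrite addr0 -scalemxAl (eigenproj_delta _ Ov) eqxx scale1r.
by rewrite -scalemxAl (eigenproj_delta _ Ov) eq_sym ji scale0r scaler0.
Qed.

Lemma Phi_comm (P : 'M[C]_d) : O *m P = P *m O -> phi *m P = P *m phi.
Proof.
move=> OP; apply: eigen_ext => i v Ov; rewrite -!mulmxA (Phi_eigen Ov) -scalemxAr.
by apply: Phi_eigen; rewrite mulmxA OP -mulmxA Ov -scalemxAr.
Qed.

Hypotheses (acN : c ^+ N - a ^+ N = 1) (a_neq0 : a != 0).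

Lemma wfun_denom_neq0 j : c - a * q ^+ (2 * j) != 0.
Proof.
apply/eqP => /subr0_eq cE; have := oner_neq0 C; rewrite -acN cE exprMn -exprM.
by rewrite mulnAC exprM qN_period expr1n mulr1 subrr eqxx.
Qed.

Lemma wfun_neq0 k : wfun (n := n) a c k != 0.
Proof.
apply: (big_ind (fun x => x != 0)) => [|x y|j _]; first exact: oner_neq0.
  exact: mulf_neq0.
by rewrite invr_eq0 wfun_denom_neq0.
Qed.

Lemma wfunS k : wfun (n := n) a c k.+1 * (c - a * q ^+ (2 * k.+1)) = wfun (n := n) a c k.
Proof. by rewrite /wfun big_nat_recr //= divfK // wfun_denom_neq0. Qed.

(** Over a full period the denominators multiply to c^N - a^N, so the constraint on a and c is what
    makes w periodic. *)
Lemma wfunN : wfun (n := n) a c N = 1.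
Proof.
rewrite /wfun prodfV; apply: invr_inj; rewrite invrK invr1 -[RHS]acN.
rewrite -(prod_sub_prim_root qN_prim) // [LHS]big_nat_recr //= [RHS]big_nat_recl //=.
rewrite mulrC qN_period expr0; congr (_ * _).
by rewrite big_add1; apply: eq_bigr => j _; rewrite exprM.
Qed.

Lemma wfun_ordD1 (i : 'I_N) :
  wfun (n := n) a c (i + ord_one)%R * (c - a * chi (i + ord_one)) = wfun (n := n) a c i.
Proof.
rewrite -(wfunS i) -ordSE /chi /=; have := ltn_ord i; rewrite ltnS leq_eqVlt.
case/orP=> [/eqP->|lt_in]; last by rewrite modn_small.
by rewrite modnn wfunN /wfun big_geq // muln0 expr0 qN_period.
Qed.

(** P raises the eigenvalue index of O by one, so the recursion of w becomes this functional
    equation of the cyclic quantum dilogarithm. *)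
Lemma Phi_shift (P : 'M[C]_d) :
  O *m P = q ^+ 2 *: (P *m O) -> P *m phi = phi *m (c%:M - a *: O) *m P.
Proof.
move=> OP; apply: eigen_ext => i v Ov.
have OPv : O *m (P *m v) = chi (i + ord_one) *: (P *m v).
  by rewrite mulmxA OP -scalemxAl -mulmxA Ov -scalemxAr scalerA chiD chi1 mulrC.
rewrite -!mulmxA (Phi_eigen Ov) mulmxBl mul_scalar_mx -scalemxAl OPv scalerA.
rewrite -scalerBl -!scalemxAr (Phi_eigen OPv) scalerA; congr (_ *: _).
by rewrite -(wfun_ordD1 i); ring.
Qed.

Hypothesis zeta_neq0 : zeta a c != 0.

Lemma Phi_unit : phi \in unitmx.
Proof.
pose psi := \sum_(j < N) (zeta a c * wfun (n := n) a c j)^-1 *: eigenproj j.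
have [|//] := @mulmx1_unit _ _ phi psi; apply: eigen_ext => i v Ov.
rewrite -mulmxA mul1mx mulmx_suml (bigD1 i) //= big1 => [|j /negbTE ji].
  rewrite addr0 -scalemxAl (eigenproj_delta _ Ov) eqxx scale1r -scalemxAr.
  by rewrite (Phi_eigen Ov) scalerA mulVf ?scale1r ?mulf_neq0 ?wfun_neq0.
by rewrite -scalemxAl (eigenproj_delta _ Ov) eq_sym ji scale0r scaler0.
Qed.

End Spectral.

(** * The intertwiner F *)

Section Intertwiner.

Context {R : realType} {n : nat}.
Local Notation C := R[i].
Local Notation N := n.+1.
Local Notation q := (qN R n).
Local Notation A := (@opA R n).
Local Notation B := (@opB R n).
Local Notation S := (@opS R n).

Lemma mul_opS p (M : 'M[C]_(N * N, p)) a b j :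
  (S *m M) (idx a b) j = M (idx a (b - a)) j.
Proof.
rewrite mxE (bigD1 (idx a (b - a))) //= big1 ?addr0.
  by rewrite mxE !mxtens_indexK /= addrC subrK eqxx mul1r.
move=> s; case: (mxtens_indexP s) => c d; rewrite mxE mxtens_indexK /= !eq_idx.
case: eqP => [->|/eqP/negbTE]; last by rewrite eq_sym => ->; rewrite mul0r.
by rewrite eqxx /= eq_sym subr_eq (addrC d) => /negbTE->; rewrite mul0r.
Qed.

Lemma mul_mx_opS p (M : 'M[C]_(p, N * N)) i a b :
  (M *m S) i (idx a b) = M i (idx a (a + b)).
Proof.
rewrite mxE (bigD1 (idx a (a + b))) //= big1 ?addr0.
  by rewrite mxE !mxtens_indexK /= eqxx mulr1.
by move=> s /negbTE sab; rewrite mxE mxtens_indexK /= sab mulr0.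
Qed.

Lemma opS_unit : S \in unitmx.
Proof.
have [|//] := @mulmx1_unit _ _ S
  (\matrix_(r, s) (let ij := mxtens_unindex s in r == idx ij.1 (ij.2 - ij.1))%:R).
apply/matrixP=> r s; case: (mxtens_indexP r) => a b; case: (mxtens_indexP s) => c d.
rewrite mul_opS !mxE mxtens_indexK /= !eq_idx.
by case: eqP => [->|//]; rewrite (inj_eq (addIr _)).
Qed.

Lemma opS_opA : S *m (A *t A) = (1%:M *t A) *m S.
Proof.
apply/matrixP=> r s; case: (mxtens_indexP r) => a b; case: (mxtens_indexP s) => c d.
rewrite mul_opS mul_mx_opS !tensmxE !mxE -!/(chi _).
case: eqP => [->|_]; last by rewrite mulr0n !mul0r.
rewrite !mulr1n mul1r (addrC c) -subr_eq; case: eqP => [_|]; last by rewrite mulr0n mulr0.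
by rewrite !mulr1n -chiD addrC.
Qed.

Lemma opS_opB : S *m (1%:M *t B) = (1%:M *t B) *m S.
Proof.
apply/matrixP=> r s; case: (mxtens_indexP r) => a b; case: (mxtens_indexP s) => c d.
rewrite mul_opS mul_mx_opS !tensmxE !mxE !ordSE.
case: eqP => [->|_]; last by rewrite !mul0r.
by rewrite subr_eq addrAC (addrC d).
Qed.

Context {rt : C -> C} {zeta : C -> C -> C}.
Hypotheses (n_odd : odd N) (rtP : root_choice R n rt) (zetaP : zeta_choice R n zeta).

(** Both sides have the same N-th power, so their ratio is a power of the primitive root q^2 and the
    search in [mexp] succeeds. *)
Lemma mexpP z w : z != 0 -> w != 0 ->
  rt (z * w) = q ^+ (2 * mexp n rt z w) * rt z * rt w.
Proof.
move=> z0 w0; rewrite /mexp; case: pickP => [m /eqP //|none].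
have rz := rt_neq0 rtP z0; have rw := rt_neq0 rtP w0.
have [|m mE] := @prim_rootP _ _ _ (@qN_prim R n) (rt (z * w) / (rt z * rt w)).
  by rewrite expr_div_n exprMn !(rtX rtP) ?mulf_neq0 // divff ?mulf_neq0.
by have /eqP[] := none m; rewrite exprM -mE -mulrA divfK ?mulf_neq0.
Qed.

(** Regularity of a pair in the closed form given by [regularP]. *)
Definition regpair (l l' : weight R) : bool :=
  [&& nonsing l, nonsing l' & (wmul l l').2 != 0].

Lemma nonsing_wmul l l' : regpair l l' -> nonsing (wmul l l').
Proof.
case/and3P=> /andP[x0 _] /andP[x0' _] y0.
by rewrite /nonsing y0 andbT mulf_neq0.
Qed.

Local Notation K := (leg1 B *m leg2 A *m leg2 (invmx B)).

Lemma phiopE : K = B *t (A *m invmx B).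
Proof. by rewrite /leg1 /leg2 !tensmx_mul !mulmx1 mul1mx. Qed.

Lemma invB_opA : invmx B *m A = q ^+ 2 *: (A *m invmx B).
Proof.
rewrite -[A in LHS](mulmxK (@opB_unit R n)) opA_opB -scalemxAl -scalemxAr.
by rewrite -(mulmxA B) mulKmx ?opB_unit.
Qed.

Lemma phiop_exp : K ^+ N = 1%:M.
Proof.
rewrite phiopE tensmx_exp opB_exp.
rewrite (qcomm_exprMn _ invB_opA) (prim_root_bin2 qN_prim) // scale1r opA_exp mul1mx.
have -> : invmx B ^+ N = B ^- N by exact: exprVn.
by rewrite opB_exp invr1 tens11.
Qed.

Lemma phiop_opA : K *m (A *t A) = (A *t A) *m K.
Proof.
by rewrite phiopE !tensmx_mul opA_opB -mulmxA invB_opA -scalemxAr tensmxZl tensmxZr.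
Qed.

Lemma phiop_opB : K *m (1%:M *t B) = B *t A.
Proof. by rewrite phiopE tensmx_mul mulmx1 mulmxKV ?opB_unit. Qed.

Section Pair.

Context (l l' : weight R).
Hypothesis ll'_reg : regpair l l'.

Let r := rt (l.2 * l'.1 + l'.2).
Let a := - (rt l.2 * rt l'.1 / r).
Let c := rt l'.2 / r.

Let r_neq0 : r != 0.
Proof. by case/and3P: ll'_reg => _ _ y0; exact: (rt_neq0 rtP y0). Qed.

Let a_neq0 : a != 0.
Proof.
case/and3P: ll'_reg => /andP[x0 y0] /andP[x0' y0'] _.
by rewrite oppr_eq0 !mulf_neq0 ?invr_eq0 ?r_neq0 ?(rt_neq0 rtP).
Qed.

(** As N is odd, the minus sign in a survives the N-th power and turns the difference into (y' + y
    x') / r^N. *)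
Let acN : c ^+ N - a ^+ N = 1.
Proof.
case/and3P: ll'_reg => /andP[x0 y0] /andP[x0' y0'] y0''.
rewrite /a exprNn -signr_odd n_odd expr1 mulN1r opprK /c !expr_div_n exprMn.
by rewrite !(rtX rtP) // -mulrDl addrC divff.
Qed.

Local Notation F := (Fmap (n := n) rt zeta l l').

Lemma Fmap_unit : F \in unitmx.
Proof.
have phi_unit := Phi_unit phiop_exp acN (zetaP acN).
rewrite /Fmap -/r -/a -/c !unitmx_mul opS_unit phi_unit !andbT.
apply: tensmx_unit; rewrite ?unitmx1 //.
by apply: (@unitrX _ (invmx B)); rewrite unitmx_inv opB_unit.
Qed.

(** Phi commutes with A (x) A, and S carries A (x) A to 1 (x) A. The power of B in F then supplies
    the q^(2m) that turns the product of the roots of x and x' into the root of x x'. *)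
Lemma Fmap_actX :
  F *m actX (wtens (Vrep rt l) (Vrep rt l')) = (1%:M *t actX (Vrep rt (wmul l l'))) *m F.
Proof.
case/and3P: ll'_reg => /andP[x0 y0] /andP[x0' y0'] _.
rewrite /= mexpP // tensmxZl !tensmxZr -!scalemxAr -!scalemxAl /Fmap.
set phi := Phi _ _ _ _; have phiA : phi *m (A *t A) = (A *t A) *m phi.
  by rewrite {}/phi; apply: Phi_comm; [exact: phiop_exp | exact: phiop_opA].
set m := mexp n rt l.1 l'.1; set Bm := leg2 (invmx B ^+ m).
have BmA : Bm *m (1%:M *t A) = q ^+ (2 * m) *: ((1%:M *t A) *m Bm).
  by rewrite /Bm /leg2 !tensmx_mul mulmx1 (qcomm_expl _ invB_opA) tensmxZr -exprM.
rewrite -!mulmxA phiA (mulmxA S) opS_opA -(mulmxA _ S) (mulmxA Bm (_ *t _)) BmA.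
rewrite -scalemxAl !scalerA -mulmxA; congr (_ *: _); ring.
Qed.

(** The parameters a and c are such that Y acts on the tensor product as r (c - a K) B_2. The
    functional equation of Phi absorbs the middle factor, and r B_2 is the action of Y on the
    target. *)
Lemma Fmap_actY :
  F *m actY (wtens (Vrep rt l) (Vrep rt l')) = (1%:M *t actY (Vrep rt (wmul l l'))) *m F.
Proof.
have Y_E : actY (wtens (Vrep rt l) (Vrep rt l'))
    = r *: ((c%:M - a *: K) *m (1%:M *t B)).
  rewrite mulmxBl mul_scalar_mx -scalemxAl phiop_opB scalerBr !scalerA.
  rewrite /= tensmxZl !tensmxZr scalerA addrC; congr (_ *: _ + _).
    by rewrite /c mulrCA divff ?mulr1.
  by rewrite -scaleNr /a mulrN opprK mulrCA divff ?mulr1.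
have phi_B : K *m (1%:M *t B) = q ^+ 2 *: ((1%:M *t B) *m K).
  by rewrite phiop_opB phiopE tensmx_mul mul1mx mulmxA -tensmxZr scalemxAl -opA_opB
    mulmxK ?opB_unit.
rewrite Y_E -scalemxAr [actY _]/= tensmxZr -scalemxAl; congr (_ *: _).
rewrite /Fmap -/r -/a -/c.
have := Phi_shift (zeta := zeta) phiop_exp acN a_neq0 phi_B.
move: (Phi _ _ _ _) (c%:M - a *: K) => phi Z phiB.
set m := mexp n rt l.1 l'.1; set Bm := leg2 (invmx B ^+ m).
have BmB : Bm *m (1%:M *t B) = (1%:M *t B) *m Bm.
  rewrite /Bm /leg2 !tensmx_mul mulmx1; congr (_ *t _).
  have := @qcomm_expl _ _ (invmx B) B 1 m.
  by rewrite expr1n !scale1r; apply; rewrite mulmxV ?mulVmx ?opB_unit.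
rewrite -!mulmxA (mulmxA phi) -phiB (mulmxA S) opS_opB -(mulmxA _ S) (mulmxA Bm (_ *t _)) BmB.
by rewrite -mulmxA.
Qed.

End Pair.

End Intertwiner.

(** * Slices and the equations of an intertwiner *)

Section Slices.

Context {K : comPzRingType} {m p : nat}.

Definition rslice r (a : 'I_m) (M : 'M[K]_(m * p, r)) : 'M_(p, r) :=
  \matrix_(b, j) M (idx a b) j.

Definition lslice r (b : 'I_p) (M : 'M[K]_(m * p, r)) : 'M_(m, r) :=
  \matrix_(a, j) M (idx a b) j.

Definition cslice r (a : 'I_m) (M : 'M[K]_(r, m * p)) : 'M_(r, p) :=
  \matrix_(i, b) M i (idx a b).

Lemma rsliceE r a (M : 'M[K]_(m * p, r)) b j : rslice a M b j = M (idx a b) j.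
Proof. exact: mxE. Qed.

Lemma lsliceE r b (M : 'M[K]_(m * p, r)) a j : lslice b M a j = M (idx a b) j.
Proof. exact: mxE. Qed.

Lemma csliceE r a (M : 'M[K]_(r, m * p)) i b : cslice a M i b = M i (idx a b).
Proof. exact: mxE. Qed.

Lemma mul_tens1mx r (Z : 'M[K]_p) (M : 'M_(m * p, r)) a b j :
  ((1%:M *t Z) *m M) (idx a b) j = (Z *m rslice a M) b j.
Proof.
rewrite !mxE sum_idx (bigD1 a) //= [X in _ + X]big1 ?addr0 => [|a' /negbTE aa'].
  by apply: eq_bigr => b' _; rewrite tensmxE !mxE eqxx mul1r.
by apply: big1 => b' _; rewrite tensmxE mxE eq_sym aa' !mul0r.
Qed.

Lemma mul_tensmx1 r (Z : 'M[K]_m) (M : 'M_(m * p, r)) a b j :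
  ((Z *t 1%:M) *m M) (idx a b) j = (Z *m lslice b M) a j.
Proof.
rewrite !mxE sum_idx exchange_big (bigD1 b) //= [X in _ + X]big1 ?addr0 => [|b' /negbTE bb'].
  by apply: eq_bigr => a' _; rewrite tensmxE !mxE eqxx mulr1.
by apply: big1 => a' _; rewrite tensmxE !mxE eq_sym bb' mulr0 mul0r.
Qed.

Lemma cslice_mul_tens1 r (Z : 'M[K]_p) (M : 'M_(r, m * p)) a :
  cslice a (M *m (1%:M *t Z)) = cslice a M *m Z.
Proof.
apply/matrixP=> i b.
rewrite !mxE sum_idx (bigD1 a) //= [X in _ + X]big1 ?addr0 => [|a' /negbTE aa'].
  by apply: eq_bigr => b' _; rewrite tensmxE !mxE eqxx mul1r.
by apply: big1 => b' _; rewrite tensmxE mxE aa' mul0r mulr0.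
Qed.

Lemma cslice_mul r s (Z : 'M[K]_(s, r)) (M : 'M_(r, m * p)) a :
  cslice a (Z *m M) = Z *m cslice a M.
Proof. by apply/matrixP=> i b; rewrite !mxE; apply: eq_bigr => j _; rewrite mxE. Qed.

Lemma rslice_mul r s (Z : 'M[K]_(r, s)) (M : 'M_(m * p, r)) a :
  rslice a (M *m Z) = rslice a M *m Z.
Proof. by apply/matrixP=> i b; rewrite !mxE; apply: eq_bigr => j _; rewrite mxE. Qed.

Lemma rslice_mul_tens1 r (Z : 'M[K]_p) (M : 'M_(m * p, r)) a :
  rslice a ((1%:M *t Z) *m M) = Z *m rslice a M.
Proof. by apply/matrixP=> b j; rewrite mxE mul_tens1mx. Qed.

End Slices.

Section Vertices.

Context {R : realType} {n : nat}.
Local Notation C := R[i].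
Local Notation N := n.+1.
Local Notation q := (qN R n).
Local Notation A := (@opA R n).
Local Notation B := (@opB R n).
Context {rt : C -> C} {zeta : C -> C -> C}.
Hypotheses (n_odd : odd N) (rtP : root_choice R n rt) (zetaP : zeta_choice R n zeta).
Local Notation V := (Vrep (n := n) rt).
Implicit Types (l : weight R).

(** A has distinct eigenvalues, so M is diagonal; B permutes the basis cyclically, so the diagonal
    is constant. *)
Lemma commutant_clock_shift (M : 'M[C]_N) :
  A *m M = M *m A -> B *m M = M *m B -> M = (M 0 0)%:M.
Proof.
move=> /matrixP AM /matrixP BM.
have diag i j : i != j -> M i j = 0.
  apply: contraNeq => Mij; apply/eqP/(@chi_inj R n)/(mulIf Mij).
  by have := AM i j; rewrite mul_opA mul_mx_opA => ->; rewrite mulrC.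
have shift k : M (ord_one *+ k) (ord_one *+ k) = M 0 0.
  elim: k => [|k <-]; first by rewrite mulr0n.
  have := BM (ord_one *+ k.+1) (ord_one *+ k).
  by rewrite mul_opB mul_mx_opB mulrSr addrK.
apply/matrixP=> i j; rewrite !mxE; case: eqVneq => [<-|/diag ->]; last by rewrite mulr0n.
rewrite mulr1n -(shift i); suff -> : ord_one *+ i = i by [].
by rewrite Zp_mulrn; apply: val_inj; rewrite /= modnMml mul1n modn_small.
Qed.

(** In this entrywise form, the check that a rotated tensor is again an intertwiner becomes scalar
    algebra. *)
Lemma HomW_entries l0 l l' (f : 'M[C]_(N * N, N)) :
  HomW (U := V l0) (V := wtens (V l) (V l')) f <->
  (forall a b c, rt l0.1 * chi c * f (idx a b) c
     = rt l.1 * rt l'.1 * chi a * chi b * f (idx a b) c) /\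
  (forall a b c, rt l0.2 * f (idx a b) (c + ord_one)
     = rt l.2 * rt l'.1 * chi b * f (idx (a - ord_one) b) c
       + rt l'.2 * f (idx a (b - ord_one)) c).
Proof.
have XE a b c : (actX (wtens (V l) (V l')) *m f) (idx a b) c
    = rt l.1 * rt l'.1 * chi a * chi b * f (idx a b) c.
  rewrite /= tensmxZl tensmxZr scalerA -scalemxAl mxE tensmx_decr -mulmxA.
  by rewrite mul_tensmx1 mul_opA lsliceE mul_tens1mx mul_opA rsliceE; ring.
have YE a b c : (actY (wtens (V l) (V l')) *m f) (idx a b) c
    = rt l.2 * rt l'.1 * chi b * f (idx (a - ord_one) b) c
       + rt l'.2 * f (idx a (b - ord_one)) c.
  rewrite /= tensmxZl !tensmxZr scalerA mulmxDl -!scalemxAl mxE.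
  rewrite [X in X + _]mxE [X in _ + X]mxE mul_tens1mx mul_opB rsliceE tensmx_decr -mulmxA.
  by rewrite mul_tensmx1 mul_opB lsliceE mul_tens1mx mul_opA rsliceE; ring.
have X0E r c : (f *m actX (V l0)) r c = rt l0.1 * chi c * f r c.
  by rewrite /= -scalemxAr mxE mul_mx_opA; ring.
have Y0E r c : (f *m actY (V l0)) r c = rt l0.2 * f r (c + ord_one).
  by rewrite /= -scalemxAr mxE mul_mx_opB.
split=> [[/matrixP fX /matrixP fY]|[fX fY]]; split.
- by move=> a b c; rewrite -X0E fX XE.
- by move=> a b c; rewrite -Y0E fY YE.
- by apply/matrixP => r c; case: (mxtens_indexP r) => a b; rewrite X0E XE fX.
- by apply/matrixP => r c; case: (mxtens_indexP r) => a b; rewrite Y0E YE fY.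
Qed.

End Vertices.

(** * Vertices *)

Section HomBasis.

Context {R : realType} {n : nat}.
Local Notation C := R[i].
Local Notation N := n.+1.
Local Notation q := (qN R n).
Local Notation A := (@opA R n).
Local Notation B := (@opB R n).
Context {rt : C -> C} {zeta : C -> C -> C}.
Hypotheses (n_odd : odd N) (rtP : root_choice R n rt) (zetaP : zeta_choice R n zeta).
Local Notation V := (Vrep (n := n) rt).

Definition vertex l l' (k : 'I_N) : 'M[C]_(N * N, N) :=
  cslice k (invmx (Fmap (n := n) rt zeta l l')).

Lemma ImapE l l' f :
  Imap rt zeta l l' f = \sum_k f k 0 *: vertex l l' k.
Proof.
apply/matrixP => r c; rewrite mxE summxE mxE sum_idx; apply: eq_bigr => k _.
rewrite (bigD1 c) //= big1 ?addr0 => [|c' /negbTE c'c]; last first.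
  by rewrite !mxE !mxtens_indexK /= c'c mulr0 mulr0.
rewrite !mxE !mxtens_indexK /= eqxx mulr1 mulrC; congr (f _ _ * _).
exact: ord1.
Qed.

Lemma Imap_bvec l l' k : Imap rt zeta l l' (bvec k) = vertex l l' k.
Proof.
rewrite ImapE (bigD1 k) //= big1 ?addr0 => [|j /negbTE jk]; rewrite mxE eqxx ?jk.
  by rewrite eqxx scale1r.
by rewrite scale0r.
Qed.

Section Pair.

Context (l l' : weight R).
Hypothesis ll'_reg : regpair l l'.
Local Notation F := (Fmap (n := n) rt zeta l l').
Let F_unit : F \in unitmx := Fmap_unit n_odd rtP zetaP ll'_reg.

Lemma invF_intertwine (P : 'M[C]_(N * N)) (Z : 'M[C]_N) :
  F *m P = (1%:M *t Z) *m F -> invmx F *m (1%:M *t Z) = P *m invmx F.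
Proof. by move=> FP; rewrite -[RHS](mulKmx F_unit) (mulmxA F) FP mulmxK. Qed.

Lemma vertex_HomW k : HomW (U := V (wmul l l')) (V := wtens (V l) (V l')) (vertex l l' k).
Proof.
split; rewrite /vertex -cslice_mul_tens1.
  by rewrite (invF_intertwine (Fmap_actX n_odd rtP ll'_reg)) cslice_mul.
by rewrite (invF_intertwine (Fmap_actY n_odd rtP ll'_reg)) cslice_mul.
Qed.

Lemma HomW_Imap (g : 'M[C]_(N * N, N)) :
  HomW (U := V (wmul l l')) (V := wtens (V l) (V l')) g ->
  exists f, Imap rt zeta l l' f = g.
Proof.
move=> [gX gY]; set G := F *m g.
have [x0 y0] := andP (nonsing_wmul ll'_reg).
have GX : G *m actX (V (wmul l l')) = (1%:M *t actX (V (wmul l l'))) *m G.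
  by rewrite /G -mulmxA gX (mulmxA F) (Fmap_actX n_odd rtP ll'_reg) -mulmxA.
have GY : G *m actY (V (wmul l l')) = (1%:M *t actY (V (wmul l l'))) *m G.
  by rewrite /G -mulmxA gY (mulmxA F) (Fmap_actY n_odd rtP ll'_reg) -mulmxA.
have GA k : A *m rslice k G = rslice k G *m A.
  apply: (scalerI (rt_neq0 rtP x0)); rewrite scalemxAl scalemxAr.
  by rewrite -rslice_mul -rslice_mul_tens1 -GX.
have GB k : B *m rslice k G = rslice k G *m B.
  apply: (scalerI (rt_neq0 rtP y0)); rewrite scalemxAl scalemxAr.
  by rewrite -rslice_mul -rslice_mul_tens1 -GY.
(* Each block of F g commutes with A and B, hence is a scalar; these scalars, read off at the entry
   (0, 0), are the coordinates of g. *)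
exists (\col_k rslice k G 0 0); rewrite -[g](mulKmx F_unit) -/G ImapE.
apply/matrixP => r c; rewrite summxE mxE sum_idx; apply: eq_bigr => k _.
transitivity ((vertex l l' k *m rslice k G) r c); last first.
  by rewrite mxE; apply: eq_bigr => c' _; rewrite csliceE rsliceE.
rewrite (commutant_clock_shift (GA k) (GB k)) mul_mx_scalar.
by rewrite [LHS]mxE [RHS]mxE; congr (_ * _); rewrite mxE.
Qed.

Lemma Imap_inj (f f' : 'cV[C]_N) : Imap rt zeta l l' f = Imap rt zeta l l' f' -> f = f'.
Proof.
move=> /(congr1 (mulmx F)); rewrite !ImapE !mulmx_sumr => ff'.
apply/colP => k.
(* Since F times the k-th vertex is the k-th block column of the identity, one entry per block
   recovers h. *)
have FJ (h : 'cV[C]_N) : (\sum_j F *m (h j 0 *: vertex l l' j)) (idx k 0) 0 = h k 0.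
  rewrite summxE (bigD1 k) //= big1 => [|j /negbTE jk].
    rewrite -scalemxAr -cslice_mul mulmxV // mxE csliceE mxE eqxx mulr1 addr0 //.
  by rewrite -scalemxAr -cslice_mul mulmxV // mxE csliceE mxE eq_idx eq_sym jk mulr0.
by rewrite -[LHS]FJ ff' FJ.
Qed.

Lemma Iinv_Imap (f : 'cV[C]_N) : Iinv rt zeta l l' (Imap rt zeta l l' f) = f.
Proof. by apply: xget_unique => // f' /Imap_inj. Qed.

End Pair.

End HomBasis.

(** * Rotation of vertices *)

Section Rotation.

Context {R : realType} {n : nat}.
Local Notation C := R[i].
Local Notation N := n.+1.
Local Notation q := (qN R n).
Context {rt : C -> C} {zeta : C -> C -> C}.
Hypotheses (n_odd : odd N) (rtP : root_choice R n rt) (zetaP : zeta_choice R n zeta).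
Local Notation V := (Vrep (n := n) rt).
Local Notation mdual l := (mexp n rt l.2 l.1^-1).

Definition Ccoef (l : weight R) (i : 'I_N) : C := chi i ^- mdual l / gauss i.
Definition Dcoef (l : weight R) (i : 'I_N) : C := chi i ^- mdual l * gauss i.

Lemma Ccoef_neq0 l i : Ccoef l i != 0.
Proof.
by apply: mulf_neq0; rewrite ?invr_eq0 ?gauss_neq0 // expf_neq0 ?chi_neq0.
Qed.

Lemma Dcoef_neq0 l i : Dcoef l i != 0.
Proof.
by apply: mulf_neq0; rewrite ?invr_eq0 ?gauss_neq0 // expf_neq0 ?chi_neq0.
Qed.

Lemma CmapE l (r i : 'I_N) : Cmap rt l r i = Ccoef l i *+ (r == - i).
Proof. by rewrite mxE /Ccoef /chi -exprM. Qed.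

Lemma DmapE l (r i : 'I_N) : Dmap rt l r i = Dcoef l i *+ (r == - i).
Proof. by rewrite mxE /Dcoef /chi -exprM. Qed.

Lemma nonsing_wdual (l : weight R) : nonsing l -> nonsing (wdual l).
Proof.
by case/andP=> x0 y0; rewrite /nonsing /= invr_eq0 x0 oppr_eq0 mulf_neq0 ?invr_eq0.
Qed.

Lemma wdualK (l : weight R) : nonsing l -> wdual (wdual l) = l.
Proof.
case: l => x y /andP[/= x0 y0]; rewrite /wdual /= invrK; congr (_, _); field.
by rewrite x0.
Qed.

Lemma rt_dual1 (l : weight R) : nonsing l -> rt (wdual l).1 = (rt l.1)^-1.
Proof. by case: rtP => _ _ rtV _ /andP[x0 _]; rewrite /= rtV. Qed.

Lemma rt_dual2 (l : weight R) : nonsing l ->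
  rt (wdual l).2 = - (q ^+ (2 * mdual l) * rt l.2 / rt l.1).
Proof.
case: rtP => _ _ rtV rtN /andP[x0 y0].
by rewrite /= rtN ?mulf_neq0 ?invr_eq0 // (mexpP rtP) ?invr_eq0 // rtV.
Qed.

(** Applying the root rule for the dual twice returns to l, so the exponents of l and of its dual
    are opposite modulo N. *)
Lemma chi_expr_mdual (l : weight R) (i : 'I_N) : nonsing l ->
  chi i ^- mdual (wdual l) = chi i ^+ mdual l :> C.
Proof.
move=> l_ns; have [x0 y0] := andP l_ns.
have [dx0 dy0] := andP (nonsing_wdual l_ns).
have qq : q ^+ (2 * mdual (wdual l)) * q ^+ (2 * mdual l) = 1.
  have := rt_dual2 (nonsing_wdual l_ns); rewrite wdualK // rt_dual1 // rt_dual2 //.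
  rewrite mulrN mulNr opprK invrK mulrA -mulrA.
  have ry := rt_neq0 rtP y0; have rx := rt_neq0 rtP x0.
  by move=> E; apply: (mulIf ry); rewrite mul1r [RHS]E; field.
suff E : chi i ^+ mdual (wdual l) * chi i ^+ mdual l = 1 :> C.
  have z0 := expf_neq0 (mdual (wdual l)) (@chi_neq0 R n i).
  by apply: (mulfI z0); rewrite divff.
rewrite /chi -!exprM -exprD !(mulnAC 2 i) -mulnDl exprM exprD qq.
exact: expr1n.
Qed.

(** The exponents [mdual] cancel and the factor [chi a] comes from [gaussN]. It is the weight left
    on an inner edge when rotated vertices are contracted there; [Ccoef_dual] is the analogue for
    C. *)
Lemma Dcoef_dualN (l : weight R) (a : 'I_N) : nonsing l ->
  Dcoef (wdual l) (- a) = Dcoef l a * chi a.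
Proof.
move=> l_ns; rewrite /Dcoef gaussN // chiN exprVn chi_expr_mdual //.
by rewrite mulrA.
Qed.

Lemma Ccoef_dual (l : weight R) (a : 'I_N) : nonsing l ->
  Ccoef (wdual l) a = Ccoef l (- a) * chi a.
Proof.
move=> l_ns; rewrite /Ccoef gaussN // chiN exprVn invrK chi_expr_mdual //.
by field; rewrite gauss_neq0 chi_neq0.
Qed.

(** Together with [DcoefN], this compares an outer edge rotated by C on one side of the identity
    with the same edge rotated by D on the other. *)
Lemma CcoefN (l : weight R) (a : 'I_N) : Ccoef l (- a) = (Dcoef l a * chi a)^-1.
Proof.
rewrite /Ccoef /Dcoef gaussN // chiN exprVn invrK; field.
by rewrite gauss_neq0 chi_neq0 expf_neq0 ?chi_neq0.
Qed.

Lemma DcoefN (l : weight R) (a : 'I_N) : Dcoef l (- a) = chi a / Ccoef l a.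
Proof.
rewrite /Ccoef /Dcoef gaussN // chiN exprVn invrK; field.
by rewrite gauss_neq0 expf_neq0 ?chi_neq0.
Qed.

Lemma mul_Cmap p l (M : 'M[C]_(N, p)) r j :
  (Cmap rt l *m M) r j = Ccoef l (- r) * M (- r) j.
Proof.
rewrite mxE (bigD1 (- r)) //= big1 ?addr0; first by rewrite CmapE opprK eqxx.
by move=> k /negbTE kr; rewrite CmapE -eqr_oppLR eq_sym kr mulr0n mul0r.
Qed.

Lemma mul_Dmap p l (M : 'M[C]_(N, p)) r j :
  (Dmap rt l *m M) r j = Dcoef l (- r) * M (- r) j.
Proof.
rewrite mxE (bigD1 (- r)) //= big1 ?addr0; first by rewrite DmapE opprK eqxx.
by move=> k /negbTE kr; rewrite DmapE -eqr_oppLR eq_sym kr mulr0n mul0r.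
Qed.

Definition rotate (l l' : weight R) (f : 'M[C]_(N * N, N)) : 'M[C]_(N * N, N) :=
  \matrix_(r, a) (let bc := mxtens_unindex r in
    Dcoef (wdual l) (- a) * Ccoef (wmul l l') (- bc.2) * f (idx (- a) bc.1) (- bc.2)).

Lemma rotateE l l' f b c a : rotate l l' f (idx b c) a
  = Dcoef (wdual l) (- a) * Ccoef (wmul l l') (- c) * f (idx (- a) b) (- c).
Proof. by rewrite mxE mxtens_indexK. Qed.

Lemma sum_tensv_bvec (g : 'M[C]_(N * N, N)) a b c :
  (castmx (mulnA N N N, erefl 1%N) (\sum_j tensv (bvec j) (g *m bvec j)))
    (idx (idx a b) c) 0 = g (idx b c) a.
Proof.
rewrite castmxE summxE.
have -> : cast_ord (esym (mulnA N N N)) (idx (idx a b) c) = idx a (idx b c).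
  by apply: val_inj; rewrite /= mulnDl mulnA addnA.
rewrite (bigD1 a) //= big1 ?addr0 => [|j /negbTE ja].
  by rewrite mxE !mxtens_indexK /= !ord1 mxE !eqxx mul1r -colE mxE.
by rewrite mxE !mxtens_indexK /= mxE eq_sym ja mul0r.
Qed.

Lemma sum_bvec_tensv (f : 'M[C]_(N * N, N)) r c :
  (\sum_j tensv (f *m bvec j) (bvec j)) (idx r c) 0 = f r c.
Proof.
rewrite summxE (bigD1 c) //= big1 ?addr0 => [|j /negbTE jc].
  by rewrite mxE !mxtens_indexK /= !ord1 [X in _ * X]mxE !eqxx mulr1 -colE mxE.
by rewrite mxE !mxtens_indexK /= [X in _ * X]mxE eq_sym jc mulr0.
Qed.

(** Comparison of the coefficients of e_a (x) e_b (x) e_c. It leaves at most one candidate for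
    [AHom]. *)
Lemma rotation_eq l l' (f g : 'M[C]_(N * N, N)) :
  castmx (mulnA N N N, erefl 1%N) (\sum_j tensv (bvec j) (g *m bvec j))
    = (Dmap rt (wdual l) *t 1%:M *t Cmap rt (wmul l l'))
        *m \sum_j tensv (f *m bvec j) (bvec j)
  <-> g = rotate l l' f.
Proof.
have rhsE a b c : ((Dmap rt (wdual l) *t 1%:M *t Cmap rt (wmul l l'))
    *m \sum_j tensv (f *m bvec j) (bvec j)) (idx (idx a b) c) 0
    = rotate l l' f (idx b c) a.
  rewrite rotateE tensmx_decr -mulmxA mul_tensmx1 mul_tensmx1 mul_Dmap !lsliceE.
  by rewrite mul_tens1mx mul_Cmap rsliceE sum_bvec_tensv mulrA.
split=> [/matrixP fg|->]; apply/matrixP => r a.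
  by case: (mxtens_indexP r) => b c; rewrite -rhsE -fg sum_tensv_bvec.
case: (mxtens_indexP r) => r' c; case: (mxtens_indexP r') => a' b.
by rewrite ord1 rhsE sum_tensv_bvec.
Qed.

Section Pair.

Context (l l' : weight R).
Hypothesis ll'_reg : regpair l l'.

Lemma wmul_dualr : wmul l' (wdual (wmul l l')) = wdual l.
Proof.
case/and3P: ll'_reg => /andP[x0 y0] /andP[x0' y0'] _.
by rewrite /wmul /wdual /=; congr (_, _); field; rewrite x0 x0'.
Qed.

Lemma regpair_dualr : regpair l' (wdual (wmul l l')).
Proof.
have l_ns : nonsing l by case/and3P: ll'_reg.
have l'_ns : nonsing l' by case/and3P: ll'_reg.
rewrite /regpair wmul_dualr l'_ns nonsing_wdual ?nonsing_wmul //=.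
by case/andP: (nonsing_wdual l_ns).
Qed.

(** Y shifts an index by one, and the linear exponent in D then yields the inverse of the q^(2
    [mdual]) by which the root of the dual weight deviates from - [rt l.2] / [rt l.1]. *)
Lemma Dcoef_shift (a : 'I_N) :
  Dcoef (wdual l) (- (a + ord_one)) * q ^+ (2 * mdual l)
  = Dcoef (wdual l) (- a) * q ^+ 2 * chi a.
Proof.
have l_ns : nonsing l by case/and3P: ll'_reg.
rewrite !Dcoef_dualN // /Dcoef gaussD1 // !chiD chi1 exprMn -(exprM q 2).
by field; rewrite !expf_neq0 ?qN_exp_neq0 ?chi_neq0 ?qN_neq0.
Qed.

Lemma Ccoef_shift m (c : 'I_N) :
  Ccoef m (- (c - ord_one)) * q ^+ (2 * mdual m) = Ccoef m (- c) * chi c.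
Proof.
rewrite -{2 3}(subrK ord_one c); move: (c - ord_one) => d.
rewrite !CcoefN /Dcoef gaussD1 // !chiD chi1 exprMn -(exprM q 2).
by field; rewrite !expf_neq0 ?qN_exp_neq0 ?chi_neq0 ?qN_neq0 ?gauss_neq0.
Qed.

Lemma HomW_rotate f :
    HomW (U := V (wmul l l')) (V := wtens (V l) (V l')) f ->
  HomW (U := V (wdual l)) (V := wtens (V l') (V (wdual (wmul l l')))) (rotate l l' f).
Proof.
have l_ns : nonsing l by case/and3P: ll'_reg.
have ll'_ns := nonsing_wmul ll'_reg.
have rx := rt_neq0 rtP (proj1 (andP l_ns)).
have rx'' := rt_neq0 rtP (proj1 (andP ll'_ns)).
move=> /HomW_entries[fX fY]; apply/HomW_entries.
rewrite !rt_dual1 // !rt_dual2 //; split=> [b c a|b c a]; rewrite !rotateE.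
  have := fX (- a) b (- c); rewrite !chiN.
  move: (Dcoef _ _) (Ccoef _ _) (f _ _) => D0 C0 f0 E.
  transitivity (D0 * C0 * chi a * chi c / (rt l.1 * rt (wmul l l').1)
      * (rt (wmul l l').1 * (chi c)^-1 * f0)).
    by field; rewrite rx rx'' chi_neq0.
  by rewrite E; field; rewrite rx rx'' chi_neq0.
(* The Y-equation of the rotated tensor involves the same three entries of f as the Y-equation of f
   at (-a, b, -c), solved for a different one. The shift lemmas match two coefficients; the
   X-equation at -(a+1) trades the remaining [chi b] for the weights of the outer indices. *)
have := fX (- (a + ord_one)) b (- c); have := fY (- a) b (- c).
rewrite !chiN chiD chi1; have := Dcoef_shift a; have := Ccoef_shift (wmul l l') c.
rewrite -[- a - ord_one]opprD.
have -> : - c + ord_one = - (c - ord_one) by rewrite opprB addrC.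
move: (Dcoef _ _) (Dcoef _ _) (Ccoef _ _) (Ccoef _ _) => D1 D0 C0 C1.
move: (f _ _) (f _ _) (f _ _) => f1 f2 f3.
move=> EC ED EY EX.
have q2 : q ^+ 2 != 0 by rewrite qN_exp_neq0.
have [ca cc] : chi a != 0 :> C /\ chi c != 0 :> C by rewrite !chi_neq0.
have EX' : rt l'.1 * chi b * f2
    = rt (wmul l l').1 * chi a * q ^+ 2 / (chi c * rt l.1) * f2.
  transitivity (chi a * q ^+ 2 / rt l.1
      * (rt l.1 * rt l'.1 / (chi a * q ^+ 2) * chi b * f2)).
    by field; rewrite ca rx qN_neq0.
  by rewrite -EX; field; rewrite ?cc ?rx ?rx''.
transitivity (- (rt l.2 / rt l.1) * (D0 * q ^+ (2 * mdual l)) * C0 * f2); first by ring.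
transitivity (rt l'.2 / rt (wmul l l').1 * chi c * (D1 * C0 * f1)
    - D1 / rt (wmul l l').1 * (C1 * q ^+ (2 * mdual (wmul l l')))
      * (rt (wmul l l').2 * f3)); last by ring.
rewrite EC ED EY -!mulrA (mulrA _ (chi b)) EX'.
by field; rewrite ?cc ?rx ?rx''.
Qed.

Lemma AHom_rotate f :
    HomW (U := V (wmul l l')) (V := wtens (V l) (V l')) f ->
  AHom rt l l' f = rotate l l' f.
Proof.
move=> fW; apply: xget_unique => [|g [_ /rotation_eq //]].
by split; [exact: HomW_rotate | exact/rotation_eq].
Qed.

Local Notation J := (@vertex R n rt zeta).
Local Notation Amx := (Amap n rt zeta l l').

Lemma Amap_rotate k :
  \sum_i Amx i k *: J l' (wdual (wmul l l')) i = rotate l l' (J l l' k).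
Proof.
have JW := vertex_HomW n_odd rtP zetaP ll'_reg k.
have := HomW_rotate JW; rewrite -{1}wmul_dualr.
move=> /(HomW_Imap n_odd rtP zetaP regpair_dualr)[h hE].
rewrite -hE ImapE; apply: eq_bigr => i _; congr (_ *: _).
by rewrite mxE Imap_bvec AHom_rotate // -hE (Iinv_Imap n_odd rtP zetaP regpair_dualr).
Qed.

(** A kernel vector v yields a combination of vertices with zero rotation; the coefficients of the
    rotation are nonzero, so the combination vanishes and v = 0. The transposes appear because
    freeness is stated for rows. *)
Lemma Amap_unit : Amx \in unitmx.
Proof.
rewrite -unitmx_tr -row_free_unit; apply: inj_row_free => v.
rewrite -{1}[v]trmxK -trmx_mul => /(congr1 trmx); rewrite trmxK trmx0 => Av0.
suff : v^T = 0 by move/(congr1 trmx); rewrite trmxK trmx0.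
apply: (Imap_inj n_odd rtP zetaP ll'_reg); rewrite !ImapE [RHS]big1; last first.
  by move=> k _; rewrite mxE scale0r.
set g := \sum_k _.
have rot_g : rotate l l' g = 0.
  transitivity (\sum_k v^T k 0 *: rotate l l' (J l l' k)).
    apply/matrixP => r c; rewrite summxE mxE /g summxE mulr_sumr.
    by apply: eq_bigr => k _; rewrite 2!mxE [RHS]mxE [rotate _ _ _ _ _]mxE /= mulrCA.
  have vE k : v^T k 0 *: rotate l l' (J l l' k)
      = \sum_i (Amx i k * v^T k 0) *: J l' (wdual (wmul l l')) i.
    rewrite -Amap_rotate scaler_sumr; apply: eq_bigr => i _.
    by rewrite scalerA mulrC.
  rewrite (eq_bigr _ (fun k _ => vE k)).
  rewrite exchange_big /= big1 // => i _; rewrite -scaler_suml.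
  by have /colP/(_ i) := Av0; rewrite !mxE => ->; rewrite scale0r.
apply/matrixP => r c; case: (mxtens_indexP r) => a b; rewrite [RHS]mxE.
have /matrixP/(_ (idx b (- c)) (- a)) := rot_g; rewrite rotateE !opprK [RHS]mxE => E.
apply: (mulfI (mulf_neq0 (Dcoef_neq0 (wdual l) a) (Ccoef_neq0 (wmul l l') c))).
by rewrite mulr0.
Qed.

End Pair.

End Rotation.

(** * The map T *)

Section Legs.

Context {R : realType} {n : nat}.
Local Notation C := R[i].
Local Notation N := n.+1.
Local Notation i3 a b c := (idx (idx a b) c).
Local Notation s23 := (@leg23_3 R n swap).

Lemma mul_swap p (M : 'M[C]_(N * N, p)) a b j :
  (swap *m M) (idx a b) j = M (idx b a) j.
Proof.
rewrite mxE (bigD1 (idx b a)) //= big1 ?addr0.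
  by rewrite mxE mxtens_indexK /= eqxx mul1r.
move=> s; case: (mxtens_indexP s) => c d; rewrite mxE mxtens_indexK /= !eq_idx.
by rewrite andbC (eq_sym b) (eq_sym a) => /negbTE->; rewrite mul0r.
Qed.

Lemma mul_mx_swap p (M : 'M[C]_(p, N * N)) i a b :
  (M *m swap) i (idx a b) = M i (idx b a).
Proof.
rewrite mxE (bigD1 (idx b a)) //= big1 ?addr0.
  by rewrite mxE mxtens_indexK /= eqxx mulr1.
by move=> s /negbTE sab; rewrite mxE mxtens_indexK /= sab mulr0.
Qed.

Lemma leg21E (M : 'M[C]_(N * N)) a b c d :
  leg21 M (idx a b) (idx c d) = M (idx b a) (idx d c).
Proof. by rewrite mul_mx_swap mul_swap. Qed.

Lemma leg21K : involutive (@leg21 R n).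
Proof.
move=> M; apply/matrixP=> r s.
by case: (mxtens_indexP r) => a b; case: (mxtens_indexP s) => c d; rewrite !leg21E.
Qed.

Lemma swapK : swap *m swap = 1%:M :> 'M[C]_(N * N).
Proof.
apply/matrixP=> r s; case: (mxtens_indexP r) => a b; case: (mxtens_indexP s) => c d.
by rewrite mul_swap !mxE mxtens_indexK /= !eq_idx andbC.
Qed.

Lemma swap_tens (P Q : 'M[C]_N) : swap *m (P *t Q) = (Q *t P) *m swap.
Proof.
apply/matrixP=> r s; case: (mxtens_indexP r) => a b; case: (mxtens_indexP s) => c d.
by rewrite mul_swap mul_mx_swap !tensmxE mulrC.
Qed.

Definition tensA (M : 'M[C]_(N * (N * N))) : 'M[C]_(N * N * N) :=
  castmx (mulnA N N N, mulnA N N N) M.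

Lemma tensAE M a b c a' b' c' :
  tensA M (i3 a b c) (i3 a' b' c') = M (idx a (idx b c)) (idx a' (idx b' c')).
Proof.
have cast_idx (u v w : 'I_N) : cast_ord (esym (mulnA N N N)) (i3 u v w) = idx u (idx v w).
  by apply: val_inj; rewrite /= mulnDl mulnA addnA.
by rewrite castmxE !cast_idx.
Qed.

Lemma tensA_tens (P Q Z : 'M[C]_N) : tensA (P *t (Q *t Z)) = (P *t Q) *t Z.
Proof.
apply/matrixP=> r s; case: (mxtens_indexP r) => r' c; case: (mxtens_indexP r') => a b.
case: (mxtens_indexP s) => s' c'; case: (mxtens_indexP s') => a' b'.
by rewrite tensAE !tensmxE mulrA.
Qed.

Lemma tensA_mul M M' : tensA (M *m M') = tensA M *m tensA M'.
Proof. by rewrite /tensA; case: _ / (mulnA N N N). Qed.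

Lemma tensAD M M' : tensA (M + M') = tensA M + tensA M'.
Proof. by rewrite /tensA; case: _ / (mulnA N N N). Qed.

Lemma leg23_mul (P Q : 'M[C]_(N * N)) : leg23_3 (P *m Q) = leg23_3 P *m leg23_3 Q.
Proof. by rewrite -[RHS]tensA_mul tensmx_mul mulmx1. Qed.

Lemma leg12_mul (P Q : 'M[C]_(N * N)) : leg12_3 (P *m Q) = leg12_3 P *m leg12_3 Q.
Proof. by rewrite /leg12_3 tensmx_mul mulmx1. Qed.

Lemma leg23_1 : leg23_3 1%:M = 1%:M :> 'M[C]_(N * N * N).
Proof. by rewrite /leg23_3 tens11; case: _ / (mulnA N N N). Qed.

Lemma leg12_1 : leg12_3 1%:M = 1%:M :> 'M[C]_(N * N * N).
Proof. exact: tens11. Qed.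

Lemma s23K : s23 *m s23 = 1%:M.
Proof. by rewrite -leg23_mul swapK leg23_1. Qed.

Lemma leg13_mul (P Q : 'M[C]_(N * N)) : leg13_3 (P *m Q) = leg13_3 P *m leg13_3 Q.
Proof.
rewrite /leg13_3 leg12_mul -!mulmxA; congr (_ *m (_ *m _)).
by rewrite (mulmxA s23 s23) s23K mul1mx.
Qed.

Lemma leg13_1 : leg13_3 1%:M = 1%:M :> 'M[C]_(N * N * N).
Proof. by rewrite /leg13_3 leg12_1 mulmx1 s23K. Qed.

Lemma s23_tens (P Q Z : 'M[C]_N) : s23 *m (P *t Q *t Z) = (P *t Z *t Q) *m s23.
Proof.
have -> : s23 = tensA (1%:M *t swap) by [].
by rewrite -!tensA_tens -!tensA_mul !tensmx_mul swap_tens mul1mx mulmx1.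
Qed.

Lemma leg13_tens (P Q : 'M[C]_N) : leg13_3 (P *t Q) = P *t 1%:M *t Q.
Proof. by rewrite /leg13_3 /leg12_3 s23_tens -mulmxA s23K mulmx1. Qed.

Lemma leg13D (P Q : 'M[C]_(N * N)) : leg13_3 (P + Q) = leg13_3 P + leg13_3 Q.
Proof. by rewrite /leg13_3 /leg12_3 tensmxDl mulmxDr mulmxDl. Qed.

Lemma leg23_tens (P Q : 'M[C]_N) : leg23_3 (P *t Q) = 1%:M *t P *t Q.
Proof. exact: tensA_tens. Qed.

Lemma leg23D (P Q : 'M[C]_(N * N)) : leg23_3 (P + Q) = leg23_3 P + leg23_3 Q.
Proof. by rewrite -[RHS]tensAD -tensmxDr. Qed.

Lemma leg23_leg1_comm (M : 'M[C]_(N * N)) (P : 'M[C]_N) :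
  leg23_3 M *m (P *t 1%:M *t 1%:M) = (P *t 1%:M *t 1%:M) *m leg23_3 M.
Proof.
have -> : leg23_3 M = tensA (1%:M *t M) by [].
by rewrite -tensA_tens tens11 -!tensA_mul !tensmx_mul !mul1mx !mulmx1.
Qed.

Lemma leg_inv d e (leg : 'M[C]_d -> 'M[C]_e) (P : 'M[C]_d) :
    {morph leg : P Q / P *m Q >-> P *m Q} -> leg 1%:M = 1%:M -> P \in unitmx ->
  leg P \in unitmx /\ invmx (leg P) = leg (invmx P).
Proof.
move=> legM leg1 P_unit; have PV : leg P *m leg (invmx P) = 1%:M.
  by rewrite -legM mulmxV.
have [legP _] := mulmx1_unit PV; split=> //.
by rewrite -[RHS]mul1mx -(mulVmx legP) -mulmxA PV mulmx1.
Qed.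

Lemma invmx_leg2 (P : 'M[C]_N) : P \in unitmx -> invmx (leg2 P) = leg2 (invmx P).
Proof.
move=> P_unit; apply: (proj2 (leg_inv _ _ P_unit)); last exact: tens11.
by move=> M M'; rewrite /leg2 tensmx_mul mul1mx.
Qed.

Definition leg12_inv := fun P => @leg_inv _ _ _ P leg12_mul leg12_1.
Definition leg13_inv := fun P => @leg_inv _ _ _ P leg13_mul leg13_1.
Definition leg23_inv := fun P => @leg_inv _ _ _ P leg23_mul leg23_1.

Lemma mul_leg12 p (P : 'M[C]_(N * N)) (M : 'M_(N * N * N, p)) a b c j :
  (leg12_3 P *m M) (i3 a b c) j
  = \sum_a' \sum_b' P (idx a b) (idx a' b') * M (i3 a' b' c) j.
Proof.
rewrite mul_tensmx1 mxE sum_idx.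
by apply: eq_bigr => a' _; apply: eq_bigr => b' _; rewrite lsliceE.
Qed.

Lemma mul_leg23 p (P : 'M[C]_(N * N)) (M : 'M_(N * N * N, p)) a b c j :
  (leg23_3 P *m M) (i3 a b c) j
  = \sum_b' \sum_c' P (idx b c) (idx b' c') * M (i3 a b' c') j.
Proof.
rewrite mxE !sum_idx (bigD1 a) //= [X in _ + X]big1 ?addr0 => [|a' /negbTE aa'].
  apply: eq_bigr => b' _; apply: eq_bigr => c' _.
  by rewrite tensAE tensmxE mxE eqxx mul1r.
apply: big1 => b' _; apply: big1 => c' _.
by rewrite tensAE tensmxE mxE eq_sym aa' !mul0r.
Qed.

Lemma mul_s23 p (M : 'M[C]_(N * N * N, p)) a b c j :
  (s23 *m M) (i3 a b c) j = M (i3 a c b) j.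
Proof.
rewrite mul_leg23 (bigD1 c) //= [X in _ + X]big1 ?addr0 => [|c' /negbTE cc'].
  rewrite (bigD1 b) //= big1 ?addr0 => [|b' /negbTE bb'].
    by rewrite mxE mxtens_indexK /= eqxx mul1r.
  by rewrite mxE mxtens_indexK /= eq_idx eq_sym bb' mul0r.
by apply: big1 => b' _; rewrite mxE mxtens_indexK /= eq_idx andbC eq_sym cc' mul0r.
Qed.

Lemma mul_leg13 p (P : 'M[C]_(N * N)) (M : 'M_(N * N * N, p)) a b c j :
  (leg13_3 P *m M) (i3 a b c) j
  = \sum_a' \sum_c' P (idx a c) (idx a' c') * M (i3 a' b c') j.
Proof.
rewrite /leg13_3 -!mulmxA mul_s23 mul_leg12.
by apply: eq_bigr => a' _; apply: eq_bigr => c' _; rewrite mul_s23.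
Qed.

(** Every third-leg block of M commutes with A and B and is therefore scalar; M0 collects the
    scalars. *)
Lemma commutant_leg3 (M : 'M[C]_(N * N * N)) :
    (1%:M *t opA) *m M = M *m (1%:M *t opA) ->
    (1%:M *t opB) *m M = M *m (1%:M *t opB) ->
  exists M0 : 'M_(N * N), M = leg12_3 M0.
Proof.
move=> MA MB; exists (\matrix_(r, s) M (idx r 0) (idx s 0)).
have blockP r s (Z : 'M[C]_N) : (1%:M *t Z) *m M = M *m (1%:M *t Z) ->
    Z *m cslice s (rslice r M) = cslice s (rslice r M) *m Z.
  by move=> MZ; rewrite -cslice_mul_tens1 -cslice_mul -rslice_mul -rslice_mul_tens1 MZ.
apply/matrixP=> i j; case: (mxtens_indexP i) => r c; case: (mxtens_indexP j) => s d.
rewrite -rsliceE -csliceE (commutant_clock_shift (blockP r s _ MA) (blockP r s _ MB)).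
by rewrite tensmxE !mxE mulr_natr.
Qed.

Lemma leg12_unit (M : 'M[C]_(N * N)) : leg12_3 M \in unitmx -> M \in unitmx.
Proof.
move=> M_unit; rewrite -row_free_unit; apply: inj_row_free => v vM.
have : (v *t (delta_mx 0 0 : 'rV_N)) *m leg12_3 M = 0.
  by rewrite tensmx_mul vM tens0mx.
move=> /(congr1 (mulmx^~ (invmx (leg12_3 M)))); rewrite mulmxK // mul0mx => /matrixP v0.
apply/rowP => s; have := v0 (idx 0 0) (idx s 0).
by rewrite tensmxE !mxE !eqxx mulr1.
Qed.

End Legs.

(** * Existence of T and its defining relation between vertex pairs *)

Section Pentagon.

Context {R : realType} {n : nat}.
Local Notation C := R[i].
Local Notation N := n.+1.
Local Notation i3 a b c := (idx (idx a b) c).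
Context {rt : C -> C} {zeta : C -> C -> C}.
Hypotheses (n_odd : odd N) (rtP : root_choice R n rt) (zetaP : zeta_choice R n zeta).
Local Notation V := (Vrep (n := n) rt).
Local Notation F := (Fmap (n := n) rt zeta).
Local Notation J := (@vertex R n rt zeta).

Lemma wmulA (l l' l'' : weight R) : wmul (wmul l l') l'' = wmul l (wmul l' l'').
Proof. by rewrite /wmul /= mulrDl !mulrA addrA. Qed.

Context (l1 l2 l3 : weight R).
Hypotheses (reg12 : regpair l1 l2) (reg43 : regpair (wmul l1 l2) l3)
  (reg23 : regpair l2 l3) (reg15 : regpair l1 (wmul l2 l3)).

Let U12 := leg12_inv (Fmap_unit n_odd rtP zetaP reg12).
Let U43 := leg23_inv (Fmap_unit n_odd rtP zetaP reg43).
Let U23 := leg23_inv (Fmap_unit n_odd rtP zetaP reg23).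
Let U15 := leg13_inv (Fmap_unit n_odd rtP zetaP reg15).

(** G1 and G2 are the two identifications of the triple tensor product with two multiplicity legs
    and a copy of V_0 in the third; T measures their quotient. *)
Let G1 := leg23_3 (F (wmul l1 l2) l3) *m leg12_3 (F l1 l2).
Let G2 := leg13_3 (F l1 (wmul l2 l3)) *m leg23_3 (F l2 l3).

Let G1_unit : G1 \in unitmx.
Proof. by rewrite unitmx_mul U12.1 U43.1. Qed.

Let G2_unit : G2 \in unitmx.
Proof. by rewrite unitmx_mul U15.1 U23.1. Qed.

Let X i := actX (V i).
Let Y i := actY (V i).
(** The twice iterated coproducts of X and Y. *)
Let XXX := X l1 *t X l2 *t X l3.
Let YXX := Y l1 *t X l2 *t X l3 + 1%:M *t Y l2 *t X l3 + 1%:M *t 1%:M *t Y l3.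

Let G1X : G1 *m XXX = (1%:M *t X (wmul (wmul l1 l2) l3)) *m G1.
Proof.
have F12 := Fmap_actX (zeta := zeta) n_odd rtP reg12.
have F43 := Fmap_actX (zeta := zeta) n_odd rtP reg43.
rewrite /G1 /XXX -mulmxA [leg12_3 _ *m _]tensmx_mul F12 mul1mx.
rewrite -[X l3]mulmx1 -tensmx_mul mulmxA -leg23_tens -leg23_mul F43 leg23_mul.
by rewrite leg23_tens tens11 mulmxA.
Qed.

Let G1Y : G1 *m YXX = (1%:M *t Y (wmul (wmul l1 l2) l3)) *m G1.
Proof.
have F12 := Fmap_actY (zeta := zeta) n_odd rtP reg12.
have F43 := Fmap_actY (zeta := zeta) n_odd rtP reg43.
have -> : YXX = actY (wtens (V l1) (V l2)) *t X l3 + 1%:M *t Y l3.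
  by rewrite /YXX /= tensmxDl tens11.
rewrite /G1 -mulmxA mulmxDr [leg12_3 _ *m _]tensmx_mul F12 mul1mx.
rewrite -[X l3]mulmx1 -tensmx_mul [leg12_3 _ *m _]tensmx_mul mul1mx mulmx1.
rewrite -{2}[F l1 l2]mul1mx -[X in _ + _ *t X]mulmx1 -tensmx_mul -mulmxDl mulmxA.
rewrite -(tens11 (K := C)) -!leg23_tens -leg23D -leg23_mul F43 leg23_mul.
by rewrite mulmxA.
Qed.

Let G2X : G2 *m XXX = (1%:M *t X (wmul l1 (wmul l2 l3))) *m G2.
Proof.
have F15 := Fmap_actX (zeta := zeta) n_odd rtP reg15.
have F23 := Fmap_actX (zeta := zeta) n_odd rtP reg23.
have -> : XXX = (X l1 *t 1%:M *t 1%:M) *m leg23_3 (X l2 *t X l3).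
  by rewrite leg23_tens !tensmx_mul mulmx1 !mul1mx.
rewrite /G2 -mulmxA (mulmxA (leg23_3 _)) leg23_leg1_comm
  -(mulmxA _ (leg23_3 _) (leg23_3 _)) -leg23_mul F23 leg23_mul.
rewrite leg23_tens (mulmxA (_ *t _)) !tensmx_mul mulmx1 !mul1mx -leg13_tens.
by rewrite mulmxA -leg13_mul F15 leg13_mul leg13_tens tens11 -(mulmxA (1%:M *t _)).
Qed.

Let G2Y : G2 *m YXX = (1%:M *t Y (wmul l1 (wmul l2 l3))) *m G2.
Proof.
have F15 := Fmap_actY (zeta := zeta) n_odd rtP reg15.
have F23X := Fmap_actX (zeta := zeta) n_odd rtP reg23.
have F23 := Fmap_actY (zeta := zeta) n_odd rtP reg23.
have -> : YXX = (Y l1 *t 1%:M *t 1%:M) *m leg23_3 (X l2 *t X l3)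
    + leg23_3 (actY (wtens (V l2) (V l3))).
  rewrite leg23_tens !tensmx_mul mulmx1 !mul1mx /= leg23D !leg23_tens.
  by rewrite addrA.
rewrite /G2; move: (F l2 l3) F23X F23 => f23 F23X F23.
rewrite -mulmxA mulmxDr (mulmxA (leg23_3 _)) leg23_leg1_comm.
rewrite -(mulmxA _ (leg23_3 _) (leg23_3 _)).
rewrite -!leg23_mul F23X F23 !leg23_mul !leg23_tens (mulmxA (_ *t _)) !tensmx_mul.
rewrite mulmx1 !mul1mx -mulmxDl -!leg13_tens -leg13D.
by rewrite mulmxA -leg13_mul F15 leg13_mul leg13_tens tens11 -(mulmxA (1%:M *t _)).
Qed.

Let Tdef T := leg13_3 (F l1 (wmul l2 l3)) *m leg23_3 (F l2 l3)
  *m invmx (leg12_3 (F l1 l2)) *m invmx (leg23_3 (F (wmul l1 l2) l3))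
  = leg12_3 (leg21 T).

Let T_exists : exists T, T \in unitmx /\ Tdef T.
Proof.
rewrite /Tdef; set O := leg13_3 _ *m _ *m _ *m _.
(* O = G2 G1^-1 commutes with the third-leg actions of X and Y on V_0. *)
have OG1 : O *m G1 = G2.
  by rewrite /O /G1 mulmxA mulmxKV ?U43.1 // mulmxKV ?U12.1.
have O_comm Z W : G1 *m W = (1%:M *t Z) *m G1 -> G2 *m W = (1%:M *t Z) *m G2 ->
    (1%:M *t Z) *m O = O *m (1%:M *t Z).
  move=> G1W G2W; rewrite -[LHS](mulmxK G1_unit) -(mulmxA _ O) OG1 -G2W -OG1 -(mulmxA O) G1W.
  by rewrite (mulmxA O _ G1) mulmxK.
have l0_ns : nonsing (wmul (wmul l1 l2) l3) := nonsing_wmul reg43.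
have [x0 y0] := andP l0_ns.
have OA : (1%:M *t opA) *m O = O *m (1%:M *t opA).
  apply: (scalerI (rt_neq0 rtP x0)).
  rewrite scalemxAl scalemxAr -tensmxZr; apply: O_comm G1X _.
  by rewrite G2X wmulA.
have OB : (1%:M *t opB) *m O = O *m (1%:M *t opB).
  apply: (scalerI (rt_neq0 rtP y0)).
  rewrite scalemxAl scalemxAr -tensmxZr; apply: O_comm G1Y _.
  by rewrite G2Y wmulA.
have [M0 OE] := commutant_leg3 OA OB; exists (leg21 M0); rewrite leg21K; split=> //.
have M0_unit : M0 \in unitmx.
  by apply: leg12_unit; rewrite -OE /O 3!unitmx_mul U15.1 U23.1 !unitmx_inv U12.1 U43.1.
have swap_unit : swap \in @unitmx C (N * N) by case: (mulmx1_unit (@swapK R n)).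
by rewrite !unitmx_mul swap_unit M0_unit.
Qed.

Lemma Tmap_def : Tdef (Tmap n rt zeta l1 l2 l3).
Proof.
by have [_] : [set T | T \in unitmx /\ Tdef T]%classic (Tmap n rt zeta l1 l2 l3)
  := xgetPex 0 T_exists.
Qed.

Let J3 j' k' b c p r :=
  \sum_s J l2 l3 j' (idx c p) s * J l1 (wmul l2 l3) k' (idx b s) r.

Let J3E (M : 'M[C]_(N * N)) b c p t r :
  (leg23_3 (invmx (F l2 l3)) *m (leg13_3 (invmx (F l1 (wmul l2 l3))) *m leg12_3 M))
    (i3 b c p) (idx t r)
  = \sum_j' \sum_k' M (idx k' j') t * J3 j' k' b c p r.
Proof.
rewrite mul_leg23; apply: eq_bigr => j' _.
under eq_bigr => s _.
  rewrite mul_leg13.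
  under eq_bigr => k' _.
    rewrite (bigD1 r) //= big1 ?addr0 => [|r' /negbTE rr']; last first.
      by rewrite tensmxE [_%:M _ _]mxE rr' mulr0 mulr0.
    rewrite tensmxE [_%:M _ _]mxE eqxx mulr1.
    over.
  rewrite mulr_sumr.
  over.
rewrite exchange_big /=; apply: eq_bigr => k' _; rewrite mulr_sumr.
by apply: eq_bigr => s _; rewrite !csliceE; ring.
Qed.

(** The vertex pairs glued along l2 l3 are the entries of the invertible matrix G2^-1, so they
    separate matrices on the two multiplicity legs. *)
Lemma vertex_pair_inj (M M' : 'M[C]_(N * N)) :
    (forall t b c p r, \sum_j' \sum_k' M (idx k' j') t * J3 j' k' b c p r
       = \sum_j' \sum_k' M' (idx k' j') t * J3 j' k' b c p r) ->
  M = M'.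
Proof.
move=> MM'; suff : leg12_3 M = leg12_3 M'.
  move/matrixP => E; apply/matrixP => r s; have := E (idx r 0) (idx s 0).
  by rewrite !tensmxE !mxE eqxx !mulr1.
have U15' : leg13_3 (invmx (F l1 (wmul l2 l3))) \in unitmx.
  by rewrite -U15.2 unitmx_inv U15.1.
have U23' : leg23_3 (invmx (F l2 l3)) \in unitmx by rewrite -U23.2 unitmx_inv U23.1.
apply: (can_inj (mulKmx U15')); apply: (can_inj (mulKmx U23')).
apply/matrixP => i j; case: (mxtens_indexP i) => i' p; case: (mxtens_indexP i') => b c.
by case: (mxtens_indexP j) => t r; rewrite !J3E.
Qed.

(** Inverting the defining relation gives G1^-1 = G2^-1 T_21, in which only inverses of F, that is
    vertices, occur; this is its entrywise form. *)
Lemma Tmap_J (j k b c p r : 'I_N) :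
  \sum_a J l1 l2 k (idx b c) a * J (wmul l1 l2) l3 j (idx a p) r
  = \sum_j' \sum_k' Tmap n rt zeta l1 l2 l3 (idx j' k') (idx j k)
      * \sum_s J l2 l3 j' (idx c p) s * J l1 (wmul l2 l3) k' (idx b s) r.
Proof.
move: (Tmap _ _ _ _ _ _) Tmap_def => T TE.
have {}TE : leg12_3 (invmx (F l1 l2)) *m leg23_3 (invmx (F (wmul l1 l2) l3))
    = leg23_3 (invmx (F l2 l3)) *m (leg13_3 (invmx (F l1 (wmul l2 l3))) *m leg12_3 (leg21 T)).
  have solve (a a' x x' t : 'M[C]_(N * N * N)) : a \in unitmx -> a' \in unitmx ->
      a *m a' *m x *m x' = t -> x *m x' = invmx a' *m (invmx a *m t).
    by move=> a_unit a'_unit <-; rewrite -!mulmxA mulKmx // mulKmx.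
  by rewrite -U12.2 -U43.2 -U23.2 -U15.2; apply: solve TE; rewrite ?U15.1 ?U23.1.
transitivity ((leg12_3 (invmx (F l1 l2)) *m leg23_3 (invmx (F (wmul l1 l2) l3)))
    (i3 b c p) (i3 k j r)); last first.
  rewrite TE J3E; apply: eq_bigr => j' _; apply: eq_bigr => k' _.
  by rewrite leg21E.
symmetry; rewrite mul_leg12 (bigD1 k) //= [X in _ + X]big1 ?addr0 => [|k' /negbTE kk'].
  apply: eq_bigr => a _; rewrite !csliceE [leg23_3 _ _ _]tensAE tensmxE mxE eqxx.
  by rewrite mul1r.
apply: big1 => a _; rewrite [leg23_3 _ _ _]tensAE tensmxE mxE kk'.
by rewrite mul0r mulr0.
Qed.

End Pentagon.

(** * The rotation identity *)

Section Main.

Context {R : realType} {n : nat}.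
Local Notation C := R[i].
Local Notation N := n.+1.
Local Notation q := (qN R n).
Context {rt : C -> C} {zeta : C -> C -> C}.
Hypotheses (n_odd : odd N) (rtP : root_choice R n rt) (zetaP : zeta_choice R n zeta).
Local Notation V := (Vrep (n := n) rt).
Local Notation J := (@vertex R n rt zeta).
Local Notation m := (mexp n rt).
Local Notation Dc := (@Dcoef R n rt).
Local Notation Cc := (@Ccoef R n rt).
Local Notation Amx := (Amap n rt zeta).

Definition tens_row (f : 'I_N -> 'I_N -> C) : 'rV[C]_(N * N) :=
  \row_i f (mxtens_unindex i).1 (mxtens_unindex i).2.

Lemma tens_rowE f a b : tens_row f 0 (idx a b) = f a b.
Proof. by rewrite mxE mxtens_indexK. Qed.

Lemma tens_row_mul p f (M : 'M[C]_(N * N, p)) t :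
  (tens_row f *m M) 0 t = \sum_a \sum_b f a b * M (idx a b) t.
Proof.
rewrite mxE sum_idx; apply: eq_bigr => a _; apply: eq_bigr => b _.
by rewrite tens_rowE.
Qed.

Lemma tens_row_ext (v : 'rV[C]_(N * N)) f :
  (forall a b, v 0 (idx a b) = f a b) -> v = tens_row f.
Proof. by move=> vf; apply/rowP => i; case: (mxtens_indexP i) => a b; rewrite tens_rowE. Qed.

Lemma tens_row_tens (x y : 'I_N -> 'I_N -> C) (P Q : 'M[C]_N) :
  tens_row (fun a b => \sum_s x s a * y s b) *m (P *t Q)
  = tens_row (fun c d => \sum_s (\sum_a P a c * x s a) * (\sum_b Q b d * y s b)).
Proof.
apply: tens_row_ext => c d; rewrite tens_row_mul.
transitivity (\sum_a \sum_s P a c * x s a * (\sum_b Q b d * y s b)).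
  apply: eq_bigr => a _; under eq_bigr do rewrite tensmxE mulr_suml.
  rewrite exchange_big /=; apply: eq_bigr => s _; rewrite mulr_sumr.
  by apply: eq_bigr => b _; ring.
by rewrite exchange_big /=; apply: eq_bigr => s _; rewrite mulr_suml.
Qed.

(** The formal skeleton of the identity: both sides take a test row W i to a multiple of U i. The
    part [kappa] depends on the row but is common to the two routes, so only k = z k' remains. *)
Lemma leg_eq_of_rows (I : Type) (W W' U U' : I -> 'rV[C]_(N * N)) (kappa : I -> C)
    (k k' z : C) (T T' : 'M[C]_(N * N)) (P P' Q Q' : 'M[C]_N) :
    (forall M M' : 'M_(N * N), (forall i, W i *m M = W i *m M') -> M = M') ->
    (forall i, W i *m leg21 T' = W' i) ->
    (forall i, W' i *m (P *t invmx Q) = (k * kappa i) *: U i) ->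
    (forall i, W i *m (P' *t invmx Q') = (k' * kappa i) *: U' i) ->
    (forall i, U' i *m T = U i) ->
    Q \in unitmx -> Q' \in unitmx -> k = z * k' ->
  leg21 T' *m invmx (leg2 Q) *m leg1 P
  = z *: (invmx (leg2 Q') *m leg1 P' *m T).
Proof.
move=> W_inj WT' W'PQ WPQ' U'T Q_unit Q'_unit kE.
have leg2_leg1 (M M' : 'M[C]_N) : leg2 M *m leg1 M' = M' *t M.
  by rewrite /leg1 /leg2 tensmx_mul mulmx1 mul1mx.
rewrite !invmx_leg2 // -mulmxA !leg2_leg1; apply: W_inj => i.
by rewrite mulmxA WT' W'PQ -scalemxAr mulmxA WPQ' -scalemxAl U'T scalerA mulrA kE.
Qed.

Section Pair.

Context (l l' : weight R).
Hypothesis ll'_reg : regpair l l'.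

(** Equivariance under X after cancelling the roots of x and x'. The entry stays on both sides
    because it may be zero. *)
Lemma vertex_weight k a b c :
  q ^+ (2 * m l.1 l'.1) * chi c * J l l' k (idx a b) c
  = chi a * chi b * J l l' k (idx a b) c.
Proof.
have /HomW_entries[JX _] := vertex_HomW n_odd rtP zetaP ll'_reg k.
have /and3P[/andP[x0 _] /andP[x0' _] _] := ll'_reg.
have rr := mulf_neq0 (rt_neq0 rtP x0) (rt_neq0 rtP x0').
apply: (mulfI rr); have := JX a b c; rewrite /= (mexpP rtP) // => E.
by rewrite !mulrA -E; ring.
Qed.

Lemma wmul_duall : wmul (wdual (wmul l l')) l = wdual l'.
Proof.
case/and3P: ll'_reg => /andP[x0 y0] /andP[x0' y0'] _.
by rewrite /wmul /wdual /=; congr (_, _); field; rewrite ?x0 ?x0'.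
Qed.

Lemma regpair_duall : regpair (wdual (wmul l l')) l.
Proof.
have l_ns : nonsing l by case/and3P: ll'_reg.
have l'_ns : nonsing l' by case/and3P: ll'_reg.
rewrite /regpair wmul_duall l_ns nonsing_wdual ?nonsing_wmul //=.
by case/andP: (nonsing_wdual l'_ns).
Qed.

Lemma Amap_invE k a b c :
  \sum_i invmx (Amx l l') i k * J l l' i (idx a b) c
  = J l' (wdual (wmul l l')) k (idx b (- c)) (- a)
    / (Dc (wdual l) a * Cc (wmul l l') c).
Proof.
have DC0 := mulf_neq0 (Dcoef_neq0 (rt := rt) (wdual l) a)
  (Ccoef_neq0 (rt := rt) (wmul l l') c).
apply: (mulIf DC0); rewrite divfK // mulr_suml.
transitivity ((\sum_i invmx (Amx l l') i k *: rotate (rt := rt) l l' (J l l' i))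
    (idx b (- c)) (- a)).
  rewrite summxE; apply: eq_bigr => i _.
  by rewrite [RHS]mxE rotateE !opprK; ring.
(* Inserting A A^-1 = 1 expresses the target vertex through rotated vertices. *)
have -> : J l' (wdual (wmul l l')) k = \sum_j (Amx l l' *m invmx (Amx l l')) j k
    *: J l' (wdual (wmul l l')) j.
  rewrite mulmxV ?(Amap_unit n_odd rtP zetaP) // (bigD1 k) //= big1 ?addr0.
    by rewrite mxE eqxx scale1r.
  by move=> j /negbTE jk; rewrite mxE jk scale0r.
congr ((_ : 'M_(N * N, N)) _ _).
under eq_bigr => i _.
  rewrite -(Amap_rotate n_odd rtP zetaP ll'_reg) scaler_sumr.
  over.
rewrite exchange_big /=; apply: eq_bigr => j _.
rewrite [(_ *m _) j k]mxE scaler_suml; apply: eq_bigr => i _.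
by rewrite scalerA mulrC.
Qed.

Lemma Amap_E k a b c :
  \sum_i Amx l l' i k * J l' (wdual (wmul l l')) i (idx b c) a
  = Dc (wdual l) (- a) * Cc (wmul l l') (- c) * J l l' k (idx (- a) b) (- c).
Proof.
have := Amap_rotate n_odd rtP zetaP ll'_reg k.
move=> /matrixP/(_ (idx b c) a); rewrite rotateE summxE => <-.
by apply: eq_bigr => i _; rewrite [RHS]mxE.
Qed.

End Pair.

Section Triple.

Context (l1 l2 l3 : weight R).
Hypothesis reg123 : regular n rt [:: l1; l2; l3].
Let l4 := wmul l1 l2.
Let l5 := wmul l2 l3.
Let l0 := wmul l4 l3.

Lemma regular3 : [/\ regpair l1 l2, regpair l4 l3, regpair l2 l3 & regpair l1 l5].
Proof.
have [/and4P[ns1 ns2 ns3 _] ynz] := (regularP n_odd rtP _).1 reg123.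
have y12 : (wmul l1 l2).2 != 0.
  exact: ynz l1 [:: l2] (prefix_infix [:: l1; l2] [:: l3]).
have y23 : (wmul l2 l3).2 != 0.
  exact: ynz l2 [:: l3] (suffix_infix [:: l1] [:: l2; l3]).
have y0 : (wmul l1 (wmul l2 l3)).2 != 0 by apply: (ynz l1 [:: l2; l3]); rewrite infix_refl.
have reg12 : regpair l1 l2 by rewrite /regpair ns1 ns2.
have reg23 : regpair l2 l3 by rewrite /regpair ns2 ns3.
split=> //; rewrite /regpair ?ns1 ?ns3 nonsing_wmul //=.
by rewrite -wmulA in y0; exact: y0.
Qed.

(** Every product of consecutive weights is l3, l1, or the dual of one of the non-singular weights
    l0, l4, l5, l2. *)
Lemma regular3_dual : regular n rt [:: l3; wdual l0; l1].
Proof.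
have [reg12 reg43 reg23 reg15] := regular3.
have ns1 : nonsing l1 by case/and3P: reg12.
have ns2 : nonsing l2 by case/and3P: reg12.
have ns3 : nonsing l3 by case/and3P: reg23.
have l0E : l0 = wmul l1 l5 by exact: wmulA.
have ns0 := nonsing_wdual (nonsing_wmul reg43).
have e5 : wmul (wdual l0) l1 = wdual l5 by rewrite l0E wmul_duall.
have y_neq0 (l : weight R) : nonsing l -> (wdual l).2 != 0.
  by move=> /nonsing_wdual/andP[].
apply/(regularP n_odd rtP); split; first by rewrite /= ns3 ns0 ns1.
move=> l t; rewrite !infix_consl !prefix_cons infixs0.
rewrite orbF => /or3P[].
- move=> /andP[/eqP -> {l}]; case: t => [_|l t]; first by case/andP: ns3.
  rewrite prefix_cons => /andP[/eqP-> {l}]; case: t => [_|l t].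
    by rewrite -[wprod _ _]/(wmul l3 (wdual l0)) (wmul_dualr reg43) y_neq0 ?nonsing_wmul.
  rewrite prefix_cons prefixs0 => /andP[/eqP-> /eqP->].
  rewrite -[wprod _ _]/(wmul l3 (wmul (wdual l0) l1)) e5 (wmul_dualr reg23).
  exact: y_neq0.
- move=> /andP[/eqP -> {l}]; case: t => [_|l t]; first by case/andP: ns0.
  rewrite prefix_cons prefixs0 => /andP[/eqP-> /eqP->].
  by rewrite -[wprod _ _]/(wmul (wdual l0) l1) e5 y_neq0 ?nonsing_wmul.
by move=> /andP[/eqP -> ]; rewrite prefixs0 => /eqP-> /=; case/andP: ns1.
Qed.

Section Rows.

Context (p0 p1 p2 p3 : 'I_N).

(** The scalar carried by the outer edges, with indices p0, ..., p3 on l0, l1, l2, l3; it is the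
    same for both composites. *)
Let K := Cc l0 (- p0) * chi p2 / (Cc (wdual l2) p2 * chi p1).

Let U j k := \sum_a J l1 l2 k (idx p1 (- p2)) a * J l4 l3 j (idx a p3) (- p0).

Lemma rotate_left_comb :
  tens_row (fun j k => \sum_a J l3 (wdual l0) j (idx p3 p0) a
      * J (wdual l4) l1 k (idx a p1) p2)
    *m (Amx l4 l3 *t invmx (Amx (wdual l4) l1))
  = (q ^+ (2 * m l1.1 l2.1) * K) *: tens_row U.
Proof.
have [reg12 reg43 reg23 reg15] := regular3.
have ns2 : nonsing l2 by case/and3P: reg12.
have ns4 := nonsing_wmul reg12.
have reg41 : regpair (wdual l4) l1 by apply: regpair_duall.
rewrite tens_row_tens; apply/esym/tens_row_ext => j k.
(* Rotation negates the index of the inner edge l4. The weight [chi a] left there is turned by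
   [vertex_weight] into q^(2m) [chi p2] / [chi p1]. *)
rewrite mxE tens_rowE /U (reindex_inj oppr_inj) mulr_sumr; apply: eq_bigr => a _.
rewrite (Amap_E reg43) (Amap_invE reg41) (wmul_duall reg12) !wdualK // -/l0.
rewrite Dcoef_dualN //; have := vertex_weight reg12 k p1 (- p2) (- a); rewrite !chiN => E.
have [D0 C0] := (Dcoef_neq0 (rt := rt) l4 a, Ccoef_neq0 (rt := rt) (wdual l2) p2).
have [c1 ca] : chi p1 != 0 :> C /\ chi a != 0 :> C by rewrite !chi_neq0.
have c2 : chi p2 != 0 :> C by exact: chi_neq0.
rewrite /K; move: E D0 C0 c1 c2 ca; move: (J l1 _ k _ _) (J l4 _ _ _ _) => x y.
move: (Dc _ a) (Cc _ p2) (Cc _ (- p0)) (q ^+ _) (chi a) (chi p1) (chi p2).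
move=> D C2 C0 z ca c1 c2 E D_neq0 C2_neq0 c1_neq0 c2_neq0 ca_neq0.
transitivity (C0 * c2 / (C2 * c1) * ca * y * (z / ca * x)); first by field; apply/and3P.
by rewrite E; field; apply/and4P.
Qed.

Lemma rotate_right_comb :
  tens_row (fun k' j' => \sum_s J l3 (wdual l5) k' (idx p3 s) p2
      * J (wdual l0) l1 j' (idx p0 p1) s)
    *m (Amx l2 l3 *t invmx (Amx (wdual l0) l1))
  = (q ^+ (2 * m l1.1 l5.1) * K) *: tens_row (fun j' k' =>
      \sum_s J l2 l3 j' (idx (- p2) p3) s * J l1 l5 k' (idx p1 s) (- p0)).
Proof.
have [reg12 reg43 reg23 reg15] := regular3.
have l0E : l0 = wmul l1 l5 by exact: wmulA.
have ns5 := nonsing_wmul reg23; have ns0 := nonsing_wmul reg43.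
have reg01 : regpair (wdual l0) l1 by rewrite l0E; apply: regpair_duall.
have e5 : wmul (wdual l0) l1 = wdual l5 by rewrite l0E wmul_duall.
rewrite tens_row_tens; apply/esym/tens_row_ext => j k.
rewrite mxE tens_rowE (reindex_inj oppr_inj) mulr_sumr; apply: eq_bigr => s _.
rewrite (Amap_E reg23) (Amap_invE reg01) e5 !wdualK // -/l5.
(* The inner edge l5 carries 1 / [chi s], which equivariance turns into q^(2m) / ([chi p0]
   [chi p1]). The factor [chi p0] then cancels when D on the edge l0 is rewritten through C. *)
rewrite Ccoef_dual //; have := vertex_weight reg15 k p1 (- s) (- p0); rewrite !chiN => E.
have [C5 D0] := (Ccoef_neq0 (rt := rt) l5 (- s), Dcoef_neq0 (rt := rt) l0 p0).
have C2 := Ccoef_neq0 (rt := rt) (wdual l2) p2.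
have [c1 cs] : chi p1 != 0 :> C /\ chi s != 0 :> C by rewrite !chi_neq0.
have [c2 c0] : chi p2 != 0 :> C /\ chi p0 != 0 :> C by rewrite !chi_neq0.
rewrite /K DcoefN // CcoefN //.
move: E C5 D0 C2 c0 c1 c2 cs; move: (J l1 _ k _ _) (J l2 _ _ _ _) => x y.
move: (Cc l5 _) (Dc _ p0) (Cc _ p2) (q ^+ _) (chi p0) (chi p1) (chi p2) (chi s).
move=> C5 D0 C2 z c0 c1 c2 cs E C5_n D0_n C2_n c0_n c1_n c2_n cs_n.
transitivity ((D0 * C2 * c1)^-1 * c2 * y * (z / c0 * x)).
  by field; rewrite C2_n c1_n D0_n c0_n.
by rewrite E; field; rewrite ?C2_n ?c1_n ?D0_n ?c0_n ?cs_n ?C5_n.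
Qed.

End Rows.

Lemma Tmap_rotate :
  leg21 (Tmap n rt zeta l3 (wdual l0) l1)
    *m invmx (leg2 (Amx (wdual l4) l1)) *m leg1 (Amx l4 l3)
  = q ^ (2%:Z * ((m l1.1 l2.1)%:Z - (m l1.1 l5.1)%:Z))
      *: (invmx (leg2 (Amx (wdual l0) l1)) *m leg1 (Amx l2 l3) *m Tmap n rt zeta l1 l2 l3).
Proof.
have [reg12 reg43 reg23 reg15] := regular3.
have l0E : l0 = wmul l1 l5 by exact: wmulA.
have e4 : wmul l3 (wdual l0) = wdual l4 by rewrite (wmul_dualr reg43).
have e5 : wmul (wdual l0) l1 = wdual l5 by rewrite l0E wmul_duall.
have reg30 : regpair l3 (wdual l0) by apply: regpair_dualr.
have reg41 : regpair (wdual l4) l1 by apply: regpair_duall.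
have reg01 : regpair (wdual l0) l1 by rewrite l0E; apply: regpair_duall.
have reg35 : regpair l3 (wdual l5) by apply: regpair_dualr.
have reg41' : regpair (wmul l3 (wdual l0)) l1 by rewrite e4.
have reg35' : regpair l3 (wmul (wdual l0) l1) by rewrite e5.
(* The test rows are the pairs glued along l5^* for the triple (l3, l0^*, l1), with p = ((p0, p1),
   (p2, p3)). *)
pose W (p : 'I_N * 'I_N * ('I_N * 'I_N)) := tens_row (fun k' j' =>
  \sum_s J l3 (wdual l5) k' (idx p.2.2 s) p.2.1 * J (wdual l0) l1 j' (idx p.1.1 p.1.2) s).
have rowW p M t : (W p *m M) 0 t = \sum_j' \sum_k' M (idx k' j') t
      * (\sum_s J (wdual l0) l1 j' (idx p.1.1 p.1.2) s
         * J l3 (wdual l5) k' (idx p.2.2 s) p.2.1).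
  rewrite tens_row_mul exchange_big /=; apply: eq_bigr => j' _; apply: eq_bigr => k' _.
  by rewrite mulrC; congr (_ * _); apply: eq_bigr => s _; rewrite mulrC.
have W_inj (M M' : 'M[C]_(N * N)) : (forall p, W p *m M = W p *m M') -> M = M'.
  move=> WMM'; apply: (vertex_pair_inj n_odd rtP zetaP reg01 reg35') => t p3 p0 p1 p2.
  by rewrite e5; have /rowP/(_ t) := WMM' ((p0, p1), (p2, p3)); rewrite !rowW.
have WT' p : W p *m leg21 (Tmap n rt zeta l3 (wdual l0) l1)
    = tens_row (fun j k => \sum_a J l3 (wdual l0) j (idx p.2.2 p.1.1) a
        * J (wdual l4) l1 k (idx a p.1.2) p.2.1).
  apply: tens_row_ext => j k; rewrite rowW.
  have := Tmap_J n_odd rtP zetaP reg30 reg41' reg01 reg35' k j p.2.2 p.1.1 p.1.2 p.2.1.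
  rewrite e4 e5 => ->; apply: eq_bigr => j' _; apply: eq_bigr => k' _.
  by rewrite leg21E.
have UT (p : 'I_N * 'I_N * ('I_N * 'I_N)) : tens_row (fun j' k' =>
      \sum_s J l2 l3 j' (idx (- p.2.1) p.2.2) s * J l1 l5 k' (idx p.1.2 s) (- p.1.1))
      *m Tmap n rt zeta l1 l2 l3
    = tens_row (fun j k => \sum_a J l1 l2 k (idx p.1.2 (- p.2.1)) a
        * J l4 l3 j (idx a p.2.2) (- p.1.1)).
  apply: tens_row_ext => j k; rewrite tens_row_mul.
  apply: etrans (esym (Tmap_J n_odd rtP zetaP reg12 reg43 reg23 reg15
    j k p.1.2 (- p.2.1) p.2.2 (- p.1.1))).
  by apply: eq_bigr => j' _; apply: eq_bigr => k' _; rewrite mulrC.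
apply: (leg_eq_of_rows W_inj WT' (fun p => rotate_left_comb p.1.1 p.1.2 p.2.1 p.2.2)
  (fun p => rotate_right_comb p.1.1 p.1.2 p.2.1 p.2.2) UT).
- by have := Amap_unit n_odd rtP zetaP reg41.
- by have := Amap_unit n_odd rtP zetaP reg01.
(* Integer powers are used since the difference of the two exponents may be negative. *)
rewrite !(exprnP q) -expfzDr ?qN_neq0 // mulrBr !PoszM.
by congr (_ ^ _); rewrite subrK.
Qed.

End Triple.
End Main.
Theorem proposition5p4 (R : realType) (n : nat) (n_odd : odd n.+1)
    (rt : R[i] -> R[i]) (rtP : root_choice R n rt)
    (zeta : R[i] -> R[i] -> R[i]) (zetaP : zeta_choice R n zeta)
    (l1 l2 l3 : weight R) (l123_reg : regular n rt [:: l1; l2; l3]) :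
  let l4 := wmul l1 l2 in
  let l5 := wmul l2 l3 in
  let l0 := wmul l4 l3 in
  let T := Tmap n rt zeta in
  let A := Amap n rt zeta in
  let m := mexp n rt in
  [/\ regular n rt [:: l3; wdual l0; l1],
      wmul l3 (wdual l0) = wdual l4,
      wmul (wdual l0) l1 = wdual l5,
      wmul (wmul l3 (wdual l0)) l1 = wdual l2
    & leg21 (T l3 (wdual l0) l1)
        *m invmx (leg2 (A (wdual l4) l1)) *m leg1 (A l4 l3)
      = qN R n ^ (2%:Z * ((m l1.1 l2.1)%:Z - (m l1.1 (l2.1 * l3.1))%:Z))
          *: (invmx (leg2 (A (wdual l0) l1)) *m leg1 (A l2 l3) *m T l1 l2 l3)].
Proof.
move=> l4 l5 l0 T A m; have [reg12 reg43 reg23 reg15] := regular3 n_odd rtP l123_reg.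
have e4 : wmul l3 (wdual l0) = wdual l4 by apply: wmul_dualr.
split=> //.
- exact: regular3_dual.
- by rewrite /l0 /l4 wmulA wmul_duall.
- by rewrite e4 wmul_duall.
- exact: Tmap_rotate.
Qed.
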